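(* For every $k\in\mathbb N$, $\mathsf{Pathwidth}(k)\rightsquigarrow \mathsf{Trees}\cap\mathsf{Pathwidth}(k)$. Quantitatively, $\mathsf{Pathwidth}(k)\overset{D}{\rightsquigarrow}\mathsf{Trees}\cap\mathsf{Pathwidth}(k)$ for some $D\le (4k)^{k^3+1}$.
   Context: Graphs are finite, undirected, without loops or parallel edges. A path decomposition of a graph $G=(V,E)$ is a path with node set $I$ together with subsets (bags) $\chi_i\subseteq V$, $i\in I$, such that the bags cover $V$, every edge has both endpoints in some bag, and for each $v\in V$ the nodes $i$ with $v\in\chi_i$ form a connected subpath. Its width is the maximum bag size minus one, and the pathwidth of $G$ is the minimum width over all its path decompositions. $\mathsf{Pathwidth}(k)$ is the family of all graphs of pathwidth at most $k$, and $\mathsf{Trees}$ is the family of connected, acyclic graphs. For a graph $G=(V,E)$ and a length function $\mathrm{len}:E\to[0,\infty)$, $d_{\mathrm{len}}$ denotes the induced shortest-path pseudometric on $V$. By convention, $d_{\mathrm{len}}(x,y)=0$ may occur for $x\ne y$, and if $G$ is disconnected there are pairs with $d_{\mathrm{len}}(x,y)=\infty$; both possibilities are allowed. A pseudometric $d$ on $V$ is supported on $G$ if $d=d_{\mathrm{len}}$ for some such $\mathrm{len}$, and is supported on a family of graphs if it is supported on some member of the family. The words ''metric'' and ''metric space'' are used with these conventions. If $(X,d)$ is a finite metric space and $\mathcal Y$ is a family of finite metric spaces, $(X,d)$ admits a stochastic $D$-embedding into $\mathcal Y$ if there exist a randomly chosen metric space $(Y,d_Y)\in\mathcal Y$ and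 a randomly chosen mapping $F:X\to Y$ such that (i) with probability one, for every $x,y\in X$, $d_Y(F(x),F(y))\ge d(x,y)$; and (ii) for every $x,y\in X$, $\mathbb E[d_Y(F(x),F(y))]\le D\cdot d(x,y)$. For graph families $\mathcal F,\mathcal G$, write $\mathcal F\overset{D}{\rightsquigarrow}\mathcal G$ if every metric supported on $\mathcal F$ admits a stochastic $D$-embedding into the family of metrics supported on $\mathcal G$, and $\mathcal F\rightsquigarrow\mathcal G$ if this holds for some $D<\infty$.
   Formalization: For disconnected graphs, where infinite distances make an embedding into a connected tree impossible, the target is forests of pathwidth at most k (expectation bound only at finite distance); the claim for trees is stated for connected graphs. *)

(* Defs.v *)
From HB Require Import structures.
From mathcomp Require Import all_boot all_order all_algebra.
From mathcomp Require Import all_classical all_reals all_analysis.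
From mathcomp Require Import measurable_realfun.
Set Implicit Arguments.
Unset Strict Implicit.
Unset Printing Implicit Defensive.
Import Order.TTheory GRing.Theory Num.Theory.
Local Open Scope ring_scope.

Record sgraph (V : finType) := SGraph {
  adj :> rel V;
  adj_sym : symmetric adj;
  adj_irrefl : irreflexive adj
}.

Definition edge_set (V : finType) (G : sgraph V) : {set {set V}} :=
  [set [set p.1; p.2]%SET | p : V * V & G p.1 p.2]%SET.

Definition graph_family := forall V : finType, sgraph V -> Prop.

Definition inter_family (F1 F2 : graph_family) : graph_family :=
  fun V G => F1 V G /\ F2 V G.

Definition Connected : graph_family := fun V G => forall x y : V, connect G x y.

(* Lists of size 2 are excluded since an edge xy gives the cyclic list x, y. *)
Definition Acyclic : graph_family :=
  fun V G => forall c : seq V, ucycle G c -> (size c <= 2)%N.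

Definition Trees : graph_family := inter_family Connected Acyclic.

(* The decomposition path has nodes 0, ..., n in this order, so a set of nodes
   induces a connected subpath iff it is convex. *)
Definition path_decomposition (V : finType) (G : sgraph V) (n : nat)
    (bag : 'I_n.+1 -> {set V}) : Prop :=
  [/\ forall v, exists i, v \in bag i,
      forall x y, G x y -> exists i, (x \in bag i) && (y \in bag i) &
      forall v (i j l : 'I_n.+1), (i <= j <= l)%N ->
        v \in bag i -> v \in bag l -> v \in bag j].

(* For the graph without vertices this gives 0 instead of -1. *)
Definition width (V : finType) (n : nat) (bag : 'I_n.+1 -> {set V}) : nat :=
  (\max_(i < n.+1) #|bag i|).-1.

Definition decomposition_width (V : finType) (G : sgraph V) : pred nat :=
  fun w => `[< exists n (bag : 'I_n.+1 -> {set V}),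
                 path_decomposition G bag /\ width bag = w >].

Lemma decomposition_width_ex (V : finType) (G : sgraph V) :
  exists w, decomposition_width G w.
Proof.
exists (width (fun _ : 'I_1 => [set: V]%SET)); apply/asboolP.
exists 0%N, (fun _ => [set: V]%SET); split => //; split.
- by move=> v; exists ord0; rewrite finset.in_setT.
- by move=> x y _; exists ord0; rewrite !finset.in_setT.
- by move=> *; rewrite finset.in_setT.
Qed.

Definition pathwidth (V : finType) (G : sgraph V) : nat :=
  ex_minn (decomposition_width_ex G).

Definition Pathwidth (k : nat) : graph_family :=
  fun V G => (pathwidth G <= k)%N.

Definition walk_length (R : realType) (V : finType) (len : {set V} -> R)
    (x : V) (p : seq V) : R :=
  \sum_(e <- pairmap (fun a b => [set a; b]%SET) x p) len e.

(* The infimum over the empty set is +oo. *)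
Definition shortest_path (R : realType) (V : finType) (G : sgraph V)
    (len : {set V} -> R) (x y : V) : \bar R :=
  ereal_inf [set (walk_length len x p)%:E |
             p in [set p | path G x p /\ last x p = y]]%classic.

Definition supported_on (R : realType) (V : finType) (G : sgraph V)
    (d : V -> V -> \bar R) : Prop :=
  exists len : {set V} -> R,
    (forall e, e \in edge_set G -> 0 <= len e) /\
    (forall x y, d x y = shortest_path G len x y).

Definition metric_family (R : realType) :=
  forall V : finType, (V -> V -> \bar R) -> Prop.

Definition metrics_supported_on (R : realType) (F : graph_family) :
    metric_family R :=
  fun V d => exists G : sgraph V, F V G /\ supported_on G d.

(* In the second condition D * +oo is read as +oo, also for D = 0, so it says
   nothing at infinite distance. *)
Definition stochastic_embedding (R : realType) (D : R) (X : finType)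
    (d : X -> X -> \bar R) (Ys : metric_family R) : Prop :=
  exists (disp : measure_display) (T : measurableType disp)
         (P : probability T R)
         (Y : T -> finType) (dY : forall w, Y w -> Y w -> \bar R)
         (F : forall w, X -> Y w),
    [/\ forall w, Ys (Y w) (dY w),
        forall x y, measurable_fun [set: T]%classic
          (fun w => dY w (F w x) (F w y)),
        {ae P, forall w, forall x y, (d x y <= dY w (F w x) (F w y))%E} &
        forall x y, (d x y < +oo)%E ->
          (\int[P]_w dY w (F w x) (F w y) <= D%:E * d x y)%E].

Definition embeds_with (R : realType) (D : R) (F1 F2 : graph_family) : Prop :=
  forall (X : finType) (d : X -> X -> \bar R),
    metrics_supported_on F1 d ->
    stochastic_embedding D d (metrics_supported_on (R := R) F2).

Definition embeds (R : realType) (F1 F2 : graph_family) : Prop :=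
  exists D : R, embeds_with D F1 F2.

(* Main.v *)
(* Choose in every component a shortest path from its leftmost to its rightmost
   bag. The union [A] of these paths meets every nonempty bag, so deleting [A]
   lowers the width by one. Cluster the remaining vertices at random, a vertex
   at distance [sg] from [A] going into a cluster of radius at most [sg / 3], so
   that an edge of length [l] is cut with probability [O(k l / sg)]. By induction
   the graph without [A] embeds into a random forest; hang one copy of this
   forest per cluster on [A], joining the centre of the cluster to its nearest
   point of [A]. A cut edge is stretched to [O(sg)], so the distortion grows by a
   factor [O(k)] only. A forest of pathwidth at most [k - 1] hung on a path at
   single vertices has pathwidth at most [k].
   The clustering is ball carving around a net of geodesics of the smaller graph,
   with radii proportional to [sg]: a point is near boundedly many centres as they
   are separated points of a geodesic, and uncovered points avoid the geodesics,
   so the width drops again. *)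
From HB Require Import structures.
Require Import Defs.
From mathcomp Require Import all_boot all_order all_algebra ring lra zify.
Set Implicit Arguments.
Unset Strict Implicit.
Unset Printing Implicit Defensive.
Import Order.TTheory GRing.Theory Num.Theory.
Local Open Scope ring_scope.

(** * Walks and distances *)

Section Walks.
Variables (R : realFieldType) (V : finType) (e : rel V) (w : V -> V -> R).

Fixpoint wlen (x : V) (p : seq V) : R :=
  if p is y :: p' then w x y + wlen y p' else 0.

Definition walkb (x y : V) (p : seq V) := path e x p && (last x p == y).

(** The bound [#|V|] makes the candidate walks a finite type, in which a minimum exists; by
    [walk_shorten] no generality is lost. *)
Definition shortest (x y : V) (p : #|V|.-bseq V) :=
  walkb x y p &&
  [forall q : #|V|.-bseq V, walkb x y q ==> (wlen x p <= wlen x q)].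

(* [0] when there is no walk from [x] to [y]. *)
Definition dist (x y : V) : R :=
  if [pick p | shortest x y p] is Some p then wlen x p else 0.

Lemma wlen_cat x p q : wlen x (p ++ q) = wlen x p + wlen (last x p) q.
Proof. by elim: p x => [|y p IH] x /=; rewrite ?add0r // IH addrA. Qed.

Hypothesis w_ge0 : forall x y, 0 <= w x y.

Lemma wlen_ge0 x p : 0 <= wlen x p.
Proof. by elim: p x => //= y p IH x; rewrite addr_ge0. Qed.

(** Loop erasure: if [x] recurs on the shortened tail, everything before the recurrence is dropped,
    which cannot lengthen a walk with nonnegative weights. *)
Lemma walk_shorten x p : path e x p ->
  exists q, [/\ path e x q, last x q = last x p, uniq (x :: q)
              & wlen x q <= wlen x p].
Proof.
elim: p x => [|y p IH] x /=; first by exists [::].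
case/andP=> exy /IH [q [pq lq uq wq]].
have [xq|xNq] := boolP (x \in y :: q); last first.
  exists (y :: q); split; rewrite /= ?exy //.
  - by rewrite xNq.
  - by rewrite lerD2l.
have [q1 [q2 Eq]] : exists q1 q2, y :: q = q1 ++ x :: q2.
  by case/splitPr: xq => q1 q2; exists q1, q2.
exists q2; split.
- have : path e y (behead (q1 ++ x :: q2)) by rewrite -Eq.
  case: (q1) Eq => [|z q1'] /= [yE _]; first by rewrite yE.
  by rewrite cat_path /= => /and3P[].
- rewrite -lq; case: (q1) Eq => [|z q1'] /= [yE ->]; first by rewrite yE.
  by rewrite last_cat.
- have : uniq (q1 ++ x :: q2) by rewrite -Eq.
  by rewrite cat_uniq => /and3P[].
- apply: le_trans (_ : wlen y q <= _); last first.
    by apply: le_trans wq _; rewrite lerDr.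
  case: (q1) Eq => [|z q1'] /= [yE ->]; first by rewrite yE.
  rewrite wlen_cat /= addrA lerDr addr_ge0 ?wlen_ge0 //.
Qed.

Lemma dist_attained x y : connect e x y ->
  exists p, [/\ path e x p, last x p = y, uniq (x :: p) & wlen x p = dist x y].
Proof.
have bsz (p : seq V) : uniq p -> (size p <= #|V|)%N.
  by move=> up; rewrite -(card_uniqP up) max_card.
case/connectP => p0 /walk_shorten [p [pp lp up _]] ly.
have sp : (size p <= #|V|)%N by apply: bsz; case/andP: up.
have Pp : walkb x y (Bseq sp) by rewrite /walkb /= pp lp ly eqxx.
case: (@arg_minP _ _ _ (Bseq sp) (fun q : #|V|.-bseq V => walkb x y q)
  (fun q : #|V|.-bseq V => wlen x q) Pp) => q Pq minq.
have : [exists q, shortest x y q].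
  apply/existsP; exists q; rewrite /shortest Pq /=.
  by apply/forallP=> r; apply/implyP=> /minq.
case/existsP => q0 sq0; rewrite /dist; case: pickP => [r|/(_ q0)]; last by rewrite sq0.
case/andP=> /andP[pr /eqP lr] /forallP minr.
(* The minimiser may still run through loops of length [0]; erasing them keeps the length, by
   minimality. *)
have [r' [pr' lr' ur' wr']] := walk_shorten pr.
exists r'; split=> //; first by rewrite lr'.
apply/eqP; rewrite eq_le wr' /=.
have sr' : (size r' <= #|V|)%N by apply: bsz; case/andP: ur'.
by have /implyP := minr (Bseq sr'); apply; rewrite /walkb /= pr' lr' lr eqxx.
Qed.

Lemma dist_le x p : path e x p -> dist x (last x p) <= wlen x p.
Proof.
move=> pp; have [q [pq lq uq wq]] := walk_shorten pp; apply: le_trans wq.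
rewrite /dist; case: pickP => [r|_]; last exact: wlen_ge0.
case/andP=> _ /forallP minr.
have sq : (size q <= #|V|)%N.
  by case/andP: uq => _ uq; rewrite -(card_uniqP uq) max_card.
by have /implyP := minr (Bseq sq); apply; rewrite /walkb /= pq lq eqxx.
Qed.

Lemma dist_not_connect x y : ~~ connect e x y -> dist x y = 0.
Proof.
rewrite /dist; case: pickP => // p /andP[/andP[pp /eqP lp] _] /negP[].
by apply/connectP; exists p.
Qed.

Lemma dist_edge x y : e x y -> dist x y <= w x y.
Proof. by move=> exy; have /= := @dist_le x [:: y]; rewrite exy addr0; apply. Qed.

Lemma dist_ge0 x y : 0 <= dist x y.
Proof. by rewrite /dist; case: pickP => // p _; apply: wlen_ge0. Qed.

Lemma distxx x : dist x x = 0.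
Proof. by apply/eqP; rewrite eq_le dist_ge0 (@dist_le x [::]). Qed.

Lemma dist_triangle x y z : connect e x y -> connect e y z ->
  dist x z <= dist x y + dist y z.
Proof.
case/dist_attained=> p [pp lp _ <-] /dist_attained [q [pq lq _ <-]].
have := @dist_le x (p ++ q); rewrite cat_path last_cat wlen_cat lp lq.
by apply; rewrite pp.
Qed.

Lemma lipschitz_walk (g : V -> R) x p :
  (forall u v, e u v -> g v <= g u + w u v) -> path e x p ->
  g (last x p) <= g x + wlen x p.
Proof.
move=> lip; elim: p x => [|y p IH] x /=; first by rewrite addr0.
by case/andP=> /lip h1 /IH h2; lra.
Qed.

(** Lower bounds on distances in the hung graph come from here, with [potential x] as [g]; with [sg]
    as [g] it compares the scales at nearby points. *)
Lemma lipschitz_dist (g : V -> R) x y :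
  (forall u v, e u v -> g v <= g u + w u v) -> connect e x y ->
  g y <= g x + dist x y.
Proof.
by move=> lip /dist_attained [p [pp <- _ <-]]; apply: lipschitz_walk.
Qed.

Hypothesis e_sym : symmetric e.
Hypothesis w_sym : forall x y, w x y = w y x.

Lemma walk_rev x p : path e x p ->
  exists q, [/\ path e (last x p) q, last (last x p) q = x
              & wlen (last x p) q = wlen x p].
Proof.
elim: p x => [|y p IH] x /=; first by exists [::].
case/andP=> exy /IH [q [pq lq wq]]; exists (rcons q x); split.
- by rewrite rcons_path pq lq e_sym.
- by rewrite last_rcons.
- by rewrite -cats1 wlen_cat lq wq /= addr0 addrC w_sym.
Qed.

Lemma dist_sym x y : dist x y = dist y x.
Proof.
have cs := sym_connect_sym e_sym.
have dle u v : connect e u v -> dist v u <= dist u v.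
  case/dist_attained=> p [/walk_rev [q [pq lq wq]] <- _ <-].
  by rewrite -wq; have := dist_le pq; rewrite lq.
have [cxy|ncxy] := boolP (connect e x y); last first.
  by rewrite !dist_not_connect // cs.
by apply/eqP; rewrite eq_le !dle // cs.
Qed.

(** If [x] lies in another component, the left side has the default value [0]. Thus the distance
    from any fixed point is 1-Lipschitz along every edge. *)
Lemma dist_lipschitz x y z : connect e y z -> dist x z <= dist x y + dist y z.
Proof.
have cs := sym_connect_sym e_sym.
move=> cyz; have [cxy|ncxy] := boolP (connect e x y).
  exact: dist_triangle.
rewrite [leLHS]dist_not_connect ?addr_ge0 ?dist_ge0 //.
by apply: contra ncxy => cxz; apply: connect_trans cxz _; rewrite cs.
Qed.

End Walks.

Lemma dist_subrel (R : realFieldType) (V : finType) (e e' : rel V)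
    (w : V -> V -> R) x y :
  (forall x y, 0 <= w x y) -> subrel e' e -> connect e' x y ->
  dist e w x y <= dist e' w x y.
Proof.
move=> w0 sub /(dist_attained w0) [p [pp <- _ <-]].
by apply: dist_le => //; apply: sub_path pp.
Qed.

Lemma dist_map (R : realFieldType) (V V' : finType) (e : rel V) (e' : rel V')
    (w : V -> V -> R) (w' : V' -> V' -> R) (h : V -> V') x y :
  (forall x y, 0 <= w x y) -> (forall x y, 0 <= w' x y) ->
  (forall x y, e x y -> e' (h x) (h y)) ->
  (forall x y, e x y -> w' (h x) (h y) <= w x y) ->
  connect e x y ->
  connect e' (h x) (h y) /\ dist e' w' (h x) (h y) <= dist e w x y.
Proof.
move=> w0 w0' he hw /(dist_attained w0) [p [pp <- _ <-]].
have [pp' lw] : path e' (h x) (map h p) /\ wlen w' (h x) (map h p) <= wlen w x p.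
  elim: p x pp => //= y' p IH x' /andP[exy /IH[h1 h2]].
  by rewrite he // h1; split=> //; apply: lerD => //; apply: hw.
split; first by apply/connectP; exists (map h p); rewrite ?last_map.
by apply: le_trans lw; rewrite -last_map; apply: dist_le.
Qed.

(** * Geodesics through all bags *)

(* A vertex without edges may lie in no bag, so that deleting vertices amounts to
   removing them from the bags; [s] bounds the bag size, not the width. *)
Definition has_pd (V : finType) (e : rel V) (s : nat) : Prop :=
  exists (n : nat) (b : nat -> {set V}),
  [/\ forall t, (n <= t)%N -> b t = set0,
      forall t, (#|b t| <= s)%N,
      forall x y, e x y -> exists t, (x \in b t) && (y \in b t) &
      forall v i j l, (i <= j <= l)%N -> v \in b i -> v \in b l -> v \in b j].

Definition del (V : finType) (e : rel V) (A : {set V}) : rel V :=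
  fun x y => [&& e x y, x \notin A & y \notin A].

Lemma del_sym (V : finType) (e : rel V) A : symmetric e -> symmetric (del e A).
Proof. by move=> es x y; rewrite /del es [(x \notin A) && _]andbC. Qed.

Lemma del_irr (V : finType) (e : rel V) A :
  irreflexive e -> irreflexive (del e A).
Proof. by move=> ei x; rewrite /del ei. Qed.

Section Geodesics.
Variables (R : realFieldType) (V : finType) (e : rel V) (w : V -> V -> R).
Hypothesis w_ge0 : forall x y, 0 <= w x y.
Hypothesis e_sym : symmetric e.
Let cs := sym_connect_sym e_sym.

Lemma connect_root_eq x y : connect e x y = (fingraph.root e x == fingraph.root e y).
Proof. by rewrite (root_connect cs). Qed.

Lemma path_conn x p : path e x p -> {in x :: p, forall y, connect e x y}.
Proof. by move=> pp y yp; apply: (path_connect pp). Qed.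

Lemma geodesic_additive s p a b : path e s p -> uniq (s :: p) ->
  wlen w s p = dist e w s (last s p) ->
  a \in s :: p -> b \in s :: p ->
  (index a (s :: p) <= index b (s :: p))%N ->
  dist e w s b = dist e w s a + dist e w a b.
Proof.
move=> pp up wp ain bin.
have [q [p3 [Ep lq]]] : exists q p3, p = q ++ p3 /\ last s q = b.
  by case/splitPl: bin => q p3 lq; exists q, p3.
move=> iab.
have aq : a \in s :: q.
  apply/negPn/negP => aNq; move: iab; rewrite Ep -cat_cons !index_cat (negPf aNq).
  rewrite -lq mem_last.
  have := mem_last s q; rewrite -index_mem => h1 h2.
  by have := leq_ltn_trans (leq_trans (leq_addr _ _) h2) h1; rewrite ltnn.
have [p1 [p2 [Eq lp1]]] : exists p1 p2, q = p1 ++ p2 /\ last s p1 = a.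
  by case/splitPl: aq => p1 p2 lp; exists p1, p2.
have lp2 : last a p2 = b by rewrite -lq Eq last_cat lp1.
move: pp; rewrite Ep Eq !cat_path !last_cat lp1 lp2 => /andP[/andP[pp1 pp2] pp3].
move: wp; rewrite Ep Eq !wlen_cat !last_cat lp1 lp2.
have := dist_le w_ge0 pp1; have := dist_le w_ge0 pp2; have := dist_le w_ge0 pp3.
rewrite lp1 lp2 => h3 h2 h1 h.
have csa : connect e s a by apply/connectP; exists p1.
have cab : connect e a b by apply/connectP; exists p2.
have cbt : connect e b (last b p3) by apply/connectP; exists p3.
have t1 := dist_triangle w_ge0 csa cab.
have t2 := dist_triangle w_ge0 (connect_trans csa cab) cbt.
by apply/eqP; rewrite eq_le t1 /=; lra.
Qed.

Variables (n : nat) (b : nat -> {set V}).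
Hypothesis b_fin : forall t, (n <= t)%N -> b t = set0.
Hypothesis b_edge : forall x y, e x y -> exists t, (x \in b t) && (y \in b t).
Hypothesis b_conv : forall v i j l,
  (i <= j <= l)%N -> v \in b i -> v \in b l -> v \in b j.

(** A discrete intermediate value argument: the first two vertices share a bag [t]. If [m <= t],
    convexity puts the first one into bag [m]; otherwise the rest of the walk starts in bag [t],
    still to the left of [m]. *)
Lemma walk_meets_bag x p i m j : path e x p -> x \in b i -> last x p \in b j ->
  (i <= m <= j)%N -> has [in b m] (x :: p).
Proof.
elim: p x i => [|y p IH] x i /=.
  by move=> _ xi xj imj; rewrite (b_conv imj).
case/andP=> exy pp xi yj /andP[im mj].
have [t /andP[xt yt]] := b_edge exy.
have [mt|tm] := leqP m t.
  by rewrite (@b_conv x i m t) ?im.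
by apply/orP; right; apply: (IH y t); rewrite // (ltnW tm).
Qed.

Lemma extreme_bags z : exists s t, [/\ connect e z s, connect e z t &
  forall v m, connect e z v -> v \in b m ->
    exists i j, [/\ (i <= m <= j)%N, s \in b i & t \in b j]].
Proof.
pose Q m := [exists v, connect e z v && (v \in b m)].
have [exQ|nQ] := boolP [exists m : 'I_n, Q m]; last first.
  (* The component meets no bag, so the claim about bags is vacuous and any endpoints do. *)
  exists z, z; split=> // v m zv vm; case/existsP: nQ.
  have mn : (m < n)%N.
    by rewrite ltnNge; apply/negP => /b_fin bm; rewrite bm inE in vm.
  by exists (Ordinal mn); apply/existsP; exists v; rewrite zv.
have {}exQ : exists m, Q m by case/existsP: exQ => m Qm; exists (val m).
have Qn m : Q m -> (m <= n)%N.
  case/existsP=> v /andP[_ vm]; rewrite leqNgt; apply/negP => /ltnW/b_fin bm.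
  by rewrite bm inE in vm.
case: (ex_minnP exQ) => m1 /existsP[s /andP[zs s1]] min1.
case: (ex_maxnP exQ Qn) => m2 /existsP[t /andP[zt t2]] max2.
exists s, t; split=> // v m zv vm; exists m1, m2.
have Qm : Q m by apply/existsP; exists v; rewrite zv.
by rewrite min1 // max2.
Qed.

Lemma component_geodesic z : exists sp : V * seq V,
  [/\ path e sp.1 sp.2, uniq (sp.1 :: sp.2), connect e z sp.1,
      wlen w sp.1 sp.2 = dist e w sp.1 (last sp.1 sp.2) &
      forall v m, connect e z v -> v \in b m -> has [in b m] (sp.1 :: sp.2)].
Proof.
have [s [t [zs zt ext]]] := extreme_bags z.
have cst : connect e s t by apply: connect_trans zt; rewrite cs.
have [p [pp lp up wp]] := dist_attained w_ge0 cst.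
exists (s, p); split=> //=; first by rewrite wp lp.
move=> v m zv vm; have [i [j [imj si tj]]] := ext _ _ zv vm.
by apply: (walk_meets_bag pp si _ imj); rewrite lp.
Qed.

End Geodesics.

(* [A] is a union of geodesics, one per component; [ix] numbers each of them
   consecutively and [f] is the arc length along it. *)
Definition geodesic_system (R : realFieldType) (V : finType) (e : rel V)
    (w : V -> V -> R) (A : {set V}) (ix : V -> nat) (f : V -> R) : Prop :=
  [/\ forall x, exists2 a, a \in A & connect e x a,
      {in A &, injective ix},
      {in A &, forall a b, connect e a b -> (ix a < ix b)%N ->
         exists c, [/\ c \in A, connect e a c & ix c = (ix a).+1]} &
      {in A &, forall a b, connect e a b -> (ix a <= ix b)%N ->
         f b - f a = dist e w a b}].

Lemma exists_geodesic_system (R : realFieldType) (V : finType) (e : rel V)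
    (w : V -> V -> R) (s : nat) :
  (forall x y, 0 <= w x y) -> symmetric e -> has_pd e s ->
  exists A ix f, geodesic_system e w A ix f /\ has_pd (del e A) s.-1.
Proof.
move=> w_ge0 e_sym [n [b [b_fin b_card b_edge b_conv]]].
have cs := sym_connect_sym e_sym.
have [g gP] := fin_all_exists
  (component_geodesic w_ge0 e_sym b_fin b_edge b_conv).
(* Choosing the geodesic of the canonical root makes [G] constant on components. *)
pose hd x := (g (fingraph.root e x)).1; pose G x := hd x :: (g (fingraph.root e x)).2.
have GP x : [/\ path e (hd x) (behead (G x)), uniq (G x), connect e x (hd x),
   wlen w (hd x) (behead (G x)) = dist e w (hd x) (last (hd x) (behead (G x))) &
   forall v m, connect e x v -> v \in b m -> has [in b m] (G x)].
  have [h1 h2 h3 h4 h5] := gP (fingraph.root e x).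
  split=> //; first by apply: connect_trans h3; apply: connect_root.
  move=> v m xv; apply: h5; apply: connect_trans xv.
  by rewrite cs; apply: connect_root.
pose A := [set x | x \in G x].
(* Every component owns a block of [#|V|] indices, long enough because a geodesic repeats no vertex;
   this makes [ix] injective across components. *)
pose ix x := (enum_rank (fingraph.root e x) * #|V| + index x (G x))%N.
pose f x := dist e w (hd x) x.
have root_eq x y : connect e x y -> fingraph.root e x = fingraph.root e y.
  by rewrite connect_root_eq // => /eqP.
have G_eq x y : connect e x y -> G x = G y by rewrite /G /hd => /root_eq ->.
have G_conn x y : y \in G x -> connect e x y.
  have [pp _ xh _ _] := GP x => yG; apply: connect_trans xh _.
  exact: (path_conn pp).
have szG x : (size (G x) <= #|V|)%N.
  by have [_ uG _ _ _] := GP x; rewrite -(card_uniqP uG) max_card.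
have inA x : (x \in A) = (x \in G x) by rewrite in_set.
have idxA x : x \in A -> (index x (G x) < #|V|)%N.
  by rewrite inA -index_mem => h; apply: leq_trans h (szG x).
have G_A x y : y \in G x -> y \in A.
  by move=> yG; rewrite inA -(G_eq _ _ (G_conn _ _ yG)).
exists A, ix, f; split; first split.
- by move=> x; exists (hd x); [apply: (@G_A x); apply: mem_head|case: (GP x)].
- move=> x y xA yA /eqP; rewrite /ix => /eqP E.
  have V0 : (0 < #|V|)%N by apply/card_gt0P; exists x.
  have Er : fingraph.root e x = fingraph.root e y.
    apply: enum_rank_inj; apply: val_inj.
    have := congr1 (fun k => k %/ #|V|)%N E.
    by rewrite !divnMDl // !divn_small ?addn0 // idxA.
  have xy : connect e x y by rewrite connect_root_eq // Er.
  move: E; rewrite Er => /addnI; rewrite (G_eq _ _ xy) => E.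
  move: xA yA; rewrite !inA (G_eq _ _ xy) => xA yA.
  by rewrite -(nth_index x xA) E nth_index.
- move=> x y xA yA xy; rewrite /ix (root_eq _ _ xy) ltn_add2l (G_eq _ _ xy) => lt.
  have ysz : (index y (G y) < size (G y))%N by move: yA; rewrite inA -index_mem.
  have [_ uG _ _ _] := GP y.
  set c := nth x (G y) (index x (G y)).+1.
  have cG : c \in G y by rewrite mem_nth // (leq_ltn_trans lt).
  have yc := G_conn _ _ cG.
  exists c; split; first exact: G_A cG.
    exact: connect_trans xy yc.
  rewrite -(root_eq _ _ yc) -(G_eq _ _ yc) index_uniq ?addnS //.
  exact: leq_ltn_trans ysz.
- move=> x y xA yA xy; rewrite /ix (root_eq _ _ xy) leq_add2l (G_eq _ _ xy) => le.
  have [pp uG _ wG _] := GP y.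
  have xG : x \in G y by move: xA; rewrite inA (G_eq _ _ xy).
  have yG : y \in G y by move: yA; rewrite inA.
  have := geodesic_additive w_ge0 pp uG wG xG yG le.
  have -> : f x = dist e w (hd y) x by rewrite /f /hd (root_eq _ _ xy).
  by rewrite /f => ->; rewrite addrAC subrr add0r.
- exists n, (fun t => b t :\: A); split.
  + by move=> t /b_fin ->; rewrite set0D.
  + move=> t; have [->|[v vt]] := set_0Vmem (b t); first by rewrite set0D cards0.
    have [_ _ _ _ /(_ v t (connect0 _ _) vt)] := GP v.
    case/hasP=> a aG at_; have aA := G_A _ _ aG.
    rewrite -ltnS; apply: leq_trans (_ : #|b t| <= _)%N; last first.
      by apply: leq_trans (b_card t) (leqSpred _).
    apply: proper_card; apply/properP; split; first exact: subsetDl.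
    by exists a; rewrite // in_setD aA.
  + move=> x y /and3P[/b_edge[t /andP[xt yt]] xA yA].
    by exists t; rewrite !in_setD xA yA xt yt.
  + move=> v i j l ijl; rewrite !in_setD => /andP[-> vi] /andP[_ vl].
    exact: b_conv ijl vi vl.
Qed.

(** Removing the point with the largest value leaves a gap of at least [d] below it, so each further
    point adds [d] to the spread. *)
Lemma separated_card (R : realFieldType) (T : finType) (S : {set T})
    (g : T -> R) (d M : R) :
  {in S &, forall p q, p != q -> d <= `|g p - g q|} ->
  {in S &, forall p q, g q - g p <= M} ->
  S != set0 -> (#|S|%:R - 1) * d <= M.
Proof.
move=> sep diam S0.
suff [p [q [pS qS h]]] :
    exists p q, [/\ p \in S, q \in S & (#|S|%:R - 1) * d <= g q - g p].
  exact: le_trans h (diam _ _ pS qS).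
move: sep S0 {diam}; move En: #|S| => m; elim: m S En => [|m IH] S Sm sep.
  by move/eqP: Sm; rewrite cards_eq0 => /eqP ->; rewrite eqxx.
case/set0Pn=> x0 x0S.
case: (@arg_maxP _ _ _ x0 [in S] g x0S) => x xS maxx.
have [E0|S'0] := eqVneq (S :\ x) set0.
  exists x, x; split=> //; have := cardsD1 x S; rewrite Sm xS E0 cards0 => -[->].
  by rewrite subrr mul0r subrr.
have S'm : #|S :\ x| = m by have := cardsD1 x S; rewrite Sm xS => -[].
have sep' : {in S :\ x &, forall p q, p != q -> d <= `|g p - g q|}.
  by move=> p q; rewrite !inE => /andP[_ pS] /andP[_ qS]; apply: sep.
have [p [q [/setD1P[_ pS] /setD1P[qx qS] h]]] := IH _ S'm sep' S'0.
exists p, x; split=> //; have := sep x q xS qS; rewrite eq_sym qx => /(_ isT).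
rewrite ger0_norm ?subr_ge0; last exact: maxx.
by rewrite -natr1; lra.
Qed.

(** * Random clustering by ball carving *)

Lemma del_subrel (V : finType) (e : rel V) A : subrel (del e A) e.
Proof. by move=> x y /and3P[]. Qed.

Lemma del_connect (V : finType) (e : rel V) A x y :
  connect (del e A) x y -> connect e x y.
Proof. by apply: connect_sub => u v /del_subrel /connect1. Qed.

Lemma has_pd1_edgeless (V : finType) (e : rel V) s :
  irreflexive e -> has_pd e s -> (s <= 1)%N -> forall x y, e x y = false.
Proof.
move=> ei [n [b [_ bc be _]]] s1 x y; apply/negP => exy.
have [t /andP[xt yt]] := be _ _ exy.
have : (#|[set x; y]| <= 1)%N.
  apply: leq_trans (leq_trans (bc t) s1); apply: subset_leq_card.
  by apply/subsetP=> z; rewrite !inE => /orP[] /eqP->.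
by rewrite cards2; case: eqP exy => [->|]; rewrite ?ei.
Qed.

Lemma card_bigcup_le (I T : finType) (S : {set I}) (B : I -> {set T}) :
  (#|\bigcup_(i in S) B i| <= \sum_(i in S) #|B i|)%N.
Proof.
elim/big_ind2: _ => [|A m C n hA hC|//]; first by rewrite cards0.
by apply: leq_trans (leq_card_setU _ _) _; apply: leq_add.
Qed.

Section Carving.
Variables (R : realFieldType) (V : finType) (e : rel V) (w : V -> V -> R).
Variables (sg : V -> R) (N : nat).
Hypothesis w_ge0 : forall x y, 0 <= w x y.
Hypothesis e_sym : symmetric e.
Hypothesis w_sym : forall x y, w x y = w y x.
Hypothesis sg_ge0 : forall x, 0 <= sg x.
Hypothesis sg_lip : forall x y, e x y -> sg y <= sg x + w x y.
Hypothesis N_gt0 : (0 < N)%N.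
Hypothesis N_big : forall x y, e x y -> w x y = 0 \/ sg x <= N%:R * w x y.

Let cs := sym_connect_sym e_sym.
Notation d := (dist e w).

Variables (A : {set V}) (ix : V -> nat) (f : V -> R).
Hypothesis A_geo : geodesic_system e w A ix f.

(** The minimum makes the condition symmetric in [p] and [q]. Only connected pairs are compared,
    since [dist] is [0] between components. *)
Definition separated (S : {set V}) :=
  (S \subset A) && [forall p in S, forall q in S,
    (p != q) && connect e p q ==> (Num.min (sg p) (sg q) / 8 < d p q)].

Lemma exists_net : exists S : {set V},
  [/\ S \subset A,
      {in S &, forall p q, p != q -> connect e p q ->
         Num.min (sg p) (sg q) / 8 < d p q} &
      forall a, a \in A -> exists p, [/\ p \in S, connect e p a & d p a <= sg p / 8]].
Proof.
have sep0 : separated set0.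
  by rewrite /separated sub0set; apply/forall_inP => p; rewrite inE.
have [S /maxsetP[sepS maxS] _] := maxset_exists sep0.
have [SA /forall_inP sS] := andP sepS.
have sepS' : {in S &, forall p q, p != q -> connect e p q ->
    Num.min (sg p) (sg q) / 8 < d p q}.
  move=> p q pS qS pq cpq; have /forall_inP/(_ q qS)/implyP := sS p pS.
  by apply; rewrite pq.
exists S; split=> // a aA.
have [|none] := boolP [exists p, [&& p \in S, connect e p a & d p a <= sg p / 8]].
  by case/existsP=> p /and3P[]; exists p.
have far p : p \in S -> connect e p a -> sg p / 8 < d p a.
  move=> pS cpa; rewrite ltNge; apply: contra none => h.
  by apply/existsP; exists p; rewrite pS cpa.
(* If [a] is far from all of [S], maximality puts it into [S]; then it would be at distance more
   than [sg a / 8] from itself. *)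
suff aS : a \in S by have := far a aS (connect0 _ _); rewrite distxx //; have := sg_ge0 a; lra.
have sepa : separated (a |: S).
  rewrite /separated subUset sub1set aA SA /=.
  apply/forall_inP => p pS; apply/forall_inP => q qS; apply/implyP=> /andP[pq cpq].
  case/setU1P: pS => [pa|pS]; case/setU1P: qS => [qa|qS].
  - by rewrite pa qa eqxx in pq.
  - rewrite pa in cpq *; rewrite dist_sym //; have := far q qS; rewrite cs => /(_ cpq).
    by apply: le_lt_trans; rewrite ler_pM2r ?invr_gt0 // ge_min lexx orbT.
  - rewrite qa in cpq *; have := far p pS cpq.
    by apply: le_lt_trans; rewrite ler_pM2r ?invr_gt0 // ge_min lexx.
  - exact: sepS'.
by rewrite -(maxS _ sepa) ?setU11 // subsetUr.
Qed.

(** The radius runs from [sg p / 8], enough for the balls of a net to cover [A], up to [sg p / 4],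
    small enough for [ball_center]. *)
Definition ball (i : 'I_N) (p x : V) :=
  connect e p x && (d p x <= (1 + i%:R / N%:R) * (sg p / 8)).

Lemma radius_bounds (i : 'I_N) : 0 <= (i%:R / N%:R : R) <= 1.
Proof.
have N0 : 0 < (N%:R : R) by rewrite ltr0n.
rewrite divr_ge0 ?ler0n //= ler_pdivrMr // mul1r ler_nat.
exact: ltnW (ltn_ord i).
Qed.

Lemma ball_dist i p x : ball i p x -> d p x <= sg p / 4.
Proof.
case/andP=> _ h; apply: le_trans h _.
have /andP[h0 h1] := radius_bounds i; have := sg_ge0 p; nra.
Qed.

(** The Lipschitz bound gives [sg p <= sg x + d x p]; together with [d x p <= sg p / 4] this leaves
    the factor [3]. *)
Lemma ball_center i p x : ball i p x -> connect e x p /\ 3 * d x p <= sg x.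
Proof.
move=> bx; have hd := ball_dist bx; have [cpx _] := andP bx.
have cxp : connect e x p by rewrite cs.
split=> //; have := lipschitz_dist w_ge0 sg_lip cxp.
by rewrite dist_sym // in hd *; lra.
Qed.

Section Edge.
Variables (x y : V).
Hypothesis exy : e x y.

Let cut p := [set i : 'I_N | ball i p x != ball i p y].

(** One endpoint lies in the ball, so [d p x <= sg p / 4 + w x y] with [w x y < sg x / 8]. The
    Lipschitz bound, used in both directions, then makes the scales at [p] and [x] comparable. *)
Lemma cut_near p : 8 * w x y < sg x -> cut p != set0 ->
  [/\ connect e p x, d p x <= sg x / 2 & sg x / 2 <= sg p].
Proof.
move=> short /set0Pn[i]; rewrite inE => bxy.
have eyx : e y x by rewrite e_sym.
have [cpx h] : connect e p x /\ d p x <= sg p / 4 + w x y.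
  have [bx|bx] := boolP (ball i p x).
    split; first by case/andP: bx.
    by have := ball_dist bx; have := w_ge0 x y; lra.
  have by_ : ball i p y by move: bxy; rewrite (negPf bx); case: ball.
  have [cpy _] := andP by_; split; first exact: connect_trans cpy (connect1 eyx).
  have := dist_triangle w_ge0 cpy (connect1 eyx).
  have := dist_edge w_ge0 eyx; have := ball_dist by_; rewrite w_sym.
  by lra.
have cxp : connect e x p by rewrite cs.
have := lipschitz_dist w_ge0 sg_lip cxp; have := lipschitz_dist w_ge0 sg_lip cpx.
rewrite (dist_sym w_ge0 e_sym w_sym x p) => h1 h2.
by split=> //; lra.
Qed.

(** The cutting radii lie between [d p x] and [d p y], hence in an interval of length at most
    [w x y], and they are spaced by [r / N] with [r >= sg x / 16]. This gives [16]; the one extra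
    radius costs [sg x <= N * w x y], whence [17]. If [w x y = 0], nothing is cut. *)
Lemma cut_card p : 8 * w x y < sg x -> #|cut p|%:R * sg x <= 17 * (N%:R * w x y).
Proof.
move=> short; have N0 : 0 < (N%:R : R) by rewrite ltr0n.
have [->|cut0] := eqVneq (cut p) set0.
  by rewrite cards0 mul0r !mulr_ge0 ?ler0n.
have [cpx _ near] := cut_near short cut0.
have cpy := connect_trans cpx (connect1 exy).
have eyx : e y x by rewrite e_sym.
have dxy : d p y <= d p x + w x y.
  by have := dist_triangle w_ge0 cpx (connect1 exy); have := dist_edge w_ge0 exy; lra.
have dyx : d p x <= d p y + w x y.
  have := dist_triangle w_ge0 cpy (connect1 eyx); have := dist_edge w_ge0 eyx.
  by rewrite (w_sym y x); lra.
set r := sg p / 8.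
have r_ge : sg x / 16 <= r by rewrite /r; lra.
have r0 : 0 < r by have := w_ge0 x y; lra.
have : (#|cut p|%:R - 1) * r <= N%:R * w x y.
  apply: (@separated_card _ _ _ (fun i : 'I_N => i%:R * r)) => // i j.
    move=> _ _ ij; rewrite -mulrBl normrM (gtr0_norm r0) ler_pMl //.
    have : (i != j :> nat) by [].
    case: ltngtP => // lt _.
      rewrite distrC -natrB; last exact: ltnW.
      by rewrite normr_nat ler1n subn_gt0.
    rewrite -natrB; last exact: ltnW.
    by rewrite normr_nat ler1n subn_gt0.
  rewrite !inE /ball cpx cpy /= -/r => hi hj.
  have : (1 + j%:R / N%:R) * r - (1 + i%:R / N%:R) * r <= w x y.
    move: hi hj; set ti := _ * r; set tj := _ * r.
    case: (leP (d p x) ti) => h1; case: (leP (d p y) ti) => h2 // _.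
      by case: (leP (d p x) tj) => h3; case: (leP (d p y) tj) => h4 // _; lra.
    by case: (leP (d p x) tj) => h3; case: (leP (d p y) tj) => h4 // _; lra.
  rewrite -(ler_pM2l N0); apply: le_trans.
  suff -> : N%:R * ((1 + j%:R / N%:R) * r - (1 + i%:R / N%:R) * r)
    = j%:R * r - i%:R * r by [].
  by field; rewrite lt0r_neq0.
case: (N_big exy) => [w0|big].
  move: cut0 => /set0Pn[i]; rewrite inE /ball cpx cpy /=.
  have -> : d p y = d p x by apply/eqP; rewrite eq_le; apply/andP; split; lra.
  by rewrite eqxx.
have card1 : 1 <= #|cut p|%:R :> R by rewrite ler1n card_gt0.
set c := #|cut p|%:R in card1 *; move=> h.
have : (c - 1) * (sg x / 16) <= N%:R * w x y.
  by apply: le_trans h; apply: ler_wpM2l r_ge; lra.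
by lra.
Qed.

(** The relevant centres lie on a single geodesic within [sg x / 2] of [x], so their [f]-values
    spread over at most [sg x], while separation keeps them [sg x / 16] apart. *)
Lemma cut_centers_card (S : {set V}) : 8 * w x y < sg x -> S \subset A ->
  {in S &, forall p q, p != q -> connect e p q ->
         Num.min (sg p) (sg q) / 8 < d p q} ->
  #|[set p in S | cut p != set0]|%:R <= (17 : R).
Proof.
move=> short; have sgx : 0 < sg x by have := w_ge0 x y; lra.
have [_ _ _ fP] := A_geo; move=> SA sep; set S' := [set p in S | _].
have S'P p : p \in S' ->
    [/\ p \in S, p \in A, connect e p x, d p x <= sg x / 2 & sg x / 2 <= sg p].
  rewrite inE => /andP[pS /(cut_near short)[? ? ?]]; split=> //; exact: (subsetP SA).
have [->|S0] := eqVneq S' set0; first by rewrite cards0 ler0n.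
have fdist p q : p \in S' -> q \in S' -> (ix p <= ix q)%N -> f q - f p = d p q.
  move=> /S'P[_ pA cpx _ _] /S'P[_ qA cqx _ _]; apply: fP => //.
  by apply: connect_trans cpx _; rewrite cs.
suff : (#|S'|%:R - 1) * (sg x / 16) <= sg x.
  by rewrite -[_ <= 17]subr_le0 -(pmulr_lle0 _ sgx); lra.
apply: (@separated_card _ _ _ f) => // p q pS' qS'.
  wlog pq : p q pS' qS' / (ix p <= ix q)%N => [hw npq|npq].
    have [|/ltnW] := leqP (ix p) (ix q) => le; first exact: hw.
    by rewrite distrC; apply: hw; rewrite // eq_sym.
  have [pS pA cpx dpx px] := S'P _ pS'; have [qS qA cqx dqx qx] := S'P _ qS'.
  have cpq : connect e p q by apply: connect_trans cpx _; rewrite cs.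
  have := sep _ _ pS qS npq cpq.
  rewrite distrC fdist // ger0_norm ?dist_ge0 // => /ltW; apply: le_trans.
  by rewrite minEle; case: ifP => _; lra.
have [le|/ltnW le] := leqP (ix p) (ix q).
  rewrite fdist //.
  have [pS pA cpx dpx px] := S'P _ pS'; have [qS qA cqx dqx qx] := S'P _ qS'.
  have cxq : connect e x q by rewrite cs.
  have := dist_triangle w_ge0 cpx cxq; rewrite (dist_sym w_ge0 e_sym w_sym x q).
  by lra.
by rewrite -opprB fdist //; have := dist_ge0 e w_ge0 q p; lra.
Qed.

End Edge.
End Carving.

(* The same [i] determines the radii of all balls, at all levels of the
   recursion: the union bound over the balls needs no independence. The radii
   [1 + i / N] discretize the uniform distribution on [[1, 2]]; [N] is large
   enough to absorb the rounding error into the constant. At most 17 balls are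
   relevant to an edge and each of them cuts it with probability at most
   [17 * w x y / sg x], whence [289]. *)
Lemma exists_centers (R : realFieldType) (V : finType) (w : V -> V -> R)
    (sg : V -> R) (N s : nat) (e : rel V) :
  (forall x y, 0 <= w x y) -> (forall x y, w x y = w y x) ->
  symmetric e -> irreflexive e -> has_pd e s -> (forall x, 0 <= sg x) ->
  (forall x y, e x y -> sg y <= sg x + w x y) ->
  (0 < N)%N -> (forall x y, e x y -> w x y = 0 \/ sg x <= N%:R * w x y) ->
  exists c : 'I_N -> V -> V,
    (forall i x, connect e x (c i x) /\ 3 * dist e w x (c i x) <= sg x) /\
    forall x y, e x y -> #|[set i | c i x != c i y]|%:R * sg x
                         <= 289 * s.-1%:R * (N%:R * w x y).
Proof.
move=> w0 ws es ei + sg0 + N0; elim: s e es ei => [|s IH] e es ei pd lip big.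
  exists (fun _ x => x); split=> [i x|x y].
    by rewrite connect0 distxx // mulr0.
  by rewrite (has_pd1_edgeless ei pd).
have [s0|s0] := posnP s.
  exists (fun _ x => x); split=> [i x|x y].
    by rewrite connect0 distxx // mulr0.
  by rewrite (has_pd1_edgeless ei pd) // s0.
have [A [ix [f [geo pd']]]] := exists_geodesic_system w0 es pd.
have es' := del_sym A es; have ei' := del_irr A ei.
have lip' x y : del e A x y -> sg y <= sg x + w x y.
  by move=> /del_subrel; apply: lip.
have big' x y : del e A x y -> w x y = 0 \/ sg x <= N%:R * w x y.
  by move=> /del_subrel; apply: big.
have [c' [c'near c'cut]] := IH _ es' ei' pd' lip' big'.
have [S [SA Ssep Snet]] := exists_net w0 es ws sg0 A.
pose bl (i : 'I_N) p x := ball e w sg i p x.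
pose c i x := if [pick p in S | bl i p x] is Some p then p else c' i x.
exists c; split=> [i x|x y exy].
  rewrite /c; case: pickP => [p /andP[_ bp]|_].
    exact: (ball_center w0 es ws sg0 lip N0 bp).
  have [cx dx] := c'near i x; split; first exact: del_connect cx.
  apply: le_trans dx; rewrite ler_pM2l //.
  exact: dist_subrel w0 (@del_subrel _ _ _) cx.
have Nw : 0 <= N%:R * w x y by rewrite mulr_ge0.
have s1 : 1 <= s%:R :> R by rewrite ler1n.
(* For an edge that is long compared with its scale, the trivial bound [N] on the number of indices
   is enough, as [8 <= 289 * s]. *)
have [long|short] := leP (sg x) (8 * w x y).
  apply: le_trans (_ : N%:R * (8 * w x y) <= _).
    apply: ler_pM => //.
    by rewrite ler_nat -[leqRHS]card_ord max_card.
  by rewrite mulrCA; apply: ler_wpM2r => //=; lra.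
pose cut p := [set i : 'I_N | bl i p x != bl i p y].
pose S' := [set p in S | cut p != set0].
pose Z := [set i : 'I_N | del e A x y && (c' i x != c' i y)].
(* An index separates [x] and [y] either through a ball of this level, or at a lower level when no
   ball contains [x] or [y]. *)
have sub : [set i | c i x != c i y] \subset (\bigcup_(p in S') cut p) :|: Z.
  apply/subsetP=> i; rewrite !inE => ci; apply/orP.
  have [/existsP[p /andP[pS bp]]|none] := boolP [exists p in S, bl i p x != bl i p y].
    left; apply/bigcupP; exists p; rewrite inE // pS.
    by apply/set0Pn; exists i; rewrite inE.
  have same p : p \in S -> bl i p x = bl i p y.
    by move=> pS; apply/eqP/negPn; apply: contra none => h; apply/existsP; exists p; rewrite pS.
  move: ci; rewrite /c.
  have -> : [pick p in S | bl i p y] = [pick p in S | bl i p x].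
    by apply: eq_pick => p /=; case pS: (p \in S) => //=; rewrite same.
  case: pickP => [p _|noball]; first by rewrite eqxx.
  (* The net covers [A] whatever the radii are, so an edge with both ends uncovered survives in
     [del e A]. *)
  have unc z : z \in A -> exists2 p, p \in S & bl i p z.
    move=> /Snet [p [pS cp dp]]; exists p => //; rewrite /bl /ball cp /=.
    have /andP[h0 h1] := radius_bounds R N0 i.
    by apply: le_trans dp _; have := sg0 p; nra.
  move=> ->; right; rewrite andbT /del exy /=; apply/andP; split.
    apply/negP=> /unc[p pS bp]; have := noball p.
    by rewrite /= pS bp.
  apply/negP=> /unc[p pS bp]; have := noball p.
  by rewrite /= pS same // bp.
apply: le_trans (_ : (\sum_(p in S') #|cut p|%:R + #|Z|%:R) * sg x <= _).
  apply: ler_wpM2r => //; rewrite -natr_sum -natrD ler_nat.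
  apply: leq_trans (subset_leq_card sub) _.
  apply: leq_trans (leq_card_setU _ _) _.
  by rewrite leq_add2r card_bigcup_le.
rewrite mulrDl mulr_suml.
have hZ : #|Z|%:R * sg x <= 289 * s.-1%:R * (N%:R * w x y).
  have [exy'|nexy'] := boolP (del e A x y).
    have := c'cut _ _ exy'; apply: le_trans; apply: ler_wpM2r => //.
    rewrite ler_nat; apply: subset_leq_card; apply/subsetP=> i.
    by rewrite !inE => /andP[].
  have -> : Z = set0 by apply/setP=> i; rewrite !inE (negPf nexy').
  by rewrite cards0 mul0r mulr_ge0 // mulr_ge0.
have hS : \sum_(p in S') #|cut p|%:R * sg x <= 289 * (N%:R * w x y).
  apply: le_trans (_ : \sum_(p in S') 17 * (N%:R * w x y) <= _).
    by apply: ler_sum => p _; apply: (cut_card w0 es ws sg0 lip N0 big exy p short).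
  rewrite sumr_const -mulr_natl.
  have h : #|S'|%:R <= (17 : R).
    exact: (cut_centers_card w0 es ws sg0 lip N0 geo exy short SA Ssep).
  nra.
have -> : s.+1.-1%:R = s.-1%:R + 1 :> R by rewrite /= natr1 prednK.
by lra.
Qed.

(** * Hanging forests on geodesics *)

(* Acyclicity in the form that is visibly preserved when forests are joined by
   single edges. *)
Definition cut_forest (Y : finType) (e : rel Y) : Prop :=
  forall x y, e x y -> exists S : {set Y},
    [/\ x \in S, y \notin S &
        forall u v, e u v -> u \in S -> v \notin S -> u = x /\ v = y].

Definition covering_pd (V : finType) (e : rel V) (s : nat) : Prop :=
  exists (n : nat) (b : nat -> {set V}),
  [/\ forall t, (n <= t)%N -> b t = set0,
      forall t, (#|b t| <= s)%N,
      forall x y, e x y -> exists t, (x \in b t) && (y \in b t),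
      forall v i j l, (i <= j <= l)%N -> v \in b i -> v \in b l -> v \in b j &
      forall v, exists t, v \in b t].

(** Each vertex outside all bags gets a singleton bag of its own behind the given bags; [0 < s]
    leaves room for it. *)
Lemma has_pd_covering (V : finType) (e : rel V) s :
  (0 < s)%N -> has_pd e s -> covering_pd e s.
Proof.
move=> s0 [n [b [bfin bcard bedge bconv]]].
pose U := [set v | [forall t : 'I_n, v \notin b t]].
have UP v t : v \in U -> v \notin b t.
  rewrite inE => /forallP vU; have [nt|tn] := leqP n t; first by rewrite bfin // inE.
  exact: (vU (Ordinal tn)).
pose b' t := if (t < n)%N then b t
             else [set v in U | n + enum_rank v == t]%N.
exists (n + #|V|)%N, b'; split.
- move=> t nt; rewrite /b' ltnNge (leq_trans (leq_addr _ _) nt) /=.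
  apply/setP=> v; rewrite !inE; apply/negP => /andP[_ /eqP E].
  by move: nt; rewrite -E leq_add2l leqNgt ltn_ord.
- move=> t; rewrite /b'; case: ifP => _ //; apply: leq_trans s0.
  apply/card_le1_eqP => u v; rewrite !inE => /andP[_ /eqP Eu] /andP[_ /eqP Ev].
  by apply: enum_rank_inj; apply: val_inj; apply: (@addnI n); rewrite Eu Ev.
- move=> x y /bedge[t xyt]; exists t; rewrite /b'; case: ltnP => // nt.
  by move: xyt; rewrite bfin ?inE.
- move=> v i j l /andP[ij jl]; rewrite /b'.
  have [li|ni] := ltnP i n; have [ll|nl] := ltnP l n.
  + by rewrite (leq_ltn_trans jl ll); apply: bconv; rewrite ij.
  + by move=> vi; rewrite inE => /andP[/(UP _ i)/negP].
  + by have := leq_ltn_trans (leq_trans ij jl) ll; rewrite ltnNge ni.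
  + rewrite ltnNge (leq_trans ni ij) /= !inE => /andP[-> /eqP Ei] /andP[_ /eqP El].
    by apply/eqP; lia.
- move=> v; have [vU|] := boolP (v \in U).
    by exists (n + enum_rank v)%N; rewrite /b' ltnNge leq_addr /= inE vU eqxx.
  rewrite inE negb_forall => /existsP[t]; rewrite negbK => vt.
  by exists (val t); rewrite /b' ltn_ord.
Qed.

Section Peel.
Variables (R : realFieldType) (V : finType) (e : rel V) (w : V -> V -> R).
Hypothesis w_ge0 : forall x y, 0 <= w x y.
Hypothesis e_sym : symmetric e.
Hypothesis w_sym : forall x y, w x y = w y x.
Let cs := sym_connect_sym e_sym.
Notation d := (dist e w).

Variables (A : {set V}) (ix : V -> nat) (f : V -> R).
Hypothesis A_geo : geodesic_system e w A ix f.
Notation e' := (del e A).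
Notation d' := (dist e' w).
Let cs' := sym_connect_sym (del_sym A e_sym).

Variables (T : finType) (eT : rel T) (wT : T -> T -> R) (F' : V -> T).
Hypothesis wT_ge0 : forall x y, 0 <= wT x y.
Hypothesis eT_sym : symmetric eT.
Hypothesis eT_irr : irreflexive eT.
Hypothesis wT_sym : forall x y, wT x y = wT y x.
Hypothesis eT_conn : forall x y, connect eT (F' x) (F' y) = connect e' x y.
Hypothesis eT_dist : forall x y, connect e' x y ->
  d' x y <= dist eT wT (F' x) (F' y).
Notation dT := (dist eT wT).

Variables (c a : V -> V).
Hypothesis c_conn : forall x, connect e' x (c x).
Hypothesis a_A : forall x, a x \in A.
Hypothesis a_conn : forall x, connect e x (a x).

(* [inl] carries the geodesics and [inr (z, _)] a copy of the forest [T] for the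
   cluster with centre [z], whether or not the cluster is empty. *)
Definition peel_adj (u v : V + V * T) : bool :=
  match u, v with
  | inl p, inl q => [&& p \in A, q \in A, connect e p q &
                      (ix q == (ix p).+1) || (ix p == (ix q).+1)]
  | inl q, inr (z, t) | inr (z, t), inl q => (q == a z) && (t == F' z)
  | inr (z, t), inr (z', t') => (z == z') && eT t t'
  end.

Definition peel_weight (u v : V + V * T) : R :=
  match u, v with
  | inl p, inl q => d p q
  | inl q, inr (z, t) | inr (z, t), inl q => d z q
  | inr (z, t), inr (z', t') => wT t t'
  end.

Definition peel_map (x : V) : V + V * T :=
  if x \in A then inl x else inr (c x, F' x).

(** The image of [x] reaches the geodesics at [inl (anchor x)]. The way there leads through the copy
    to the root [F' (c x)] and over the bridge; [offset x] is the length of these two pieces. *)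
Definition anchor (x : V) : V := if x \in A then x else a (c x).
Definition offset (x : V) : R :=
  if x \in A then 0 else dT (F' x) (F' (c x)) + d (c x) (a (c x)).

Lemma peel_weight_ge0 u v : 0 <= peel_weight u v.
Proof. by case: u v => [p|[z t]] [q|[z' t']] /=; rewrite ?dist_ge0. Qed.

Lemma peel_weight_sym u v : peel_weight u v = peel_weight v u.
Proof. by case: u v => [p|[z t]] [q|[z' t']] //=; rewrite dist_sym. Qed.

Lemma peel_sym : symmetric peel_adj.
Proof.
move=> [p|[z t]] [q|[z' t']] //=; last by rewrite eq_sym eT_sym.
by rewrite cs orbC; case: (p \in A); case: (q \in A).
Qed.

Lemma peel_irr : irreflexive peel_adj.
Proof.
move=> [p|[z t]] /=; last by rewrite eT_irr andbF.
by rewrite orbb ltn_eqF // !andbF.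
Qed.

Definition peel_pos (u : V + V * T) : nat :=
  match u with inl p => ix p | inr (z, _) => ix (a z) end.

(** An edge of a geodesic is cut by comparing [peel_pos], the index at which a vertex hangs. A
    bridge cuts off one whole copy. For an edge inside the copy at [z], the cut of [T] is extended
    by putting everything else on the side of [F' z]. *)
Lemma peel_cut_forest : cut_forest eT -> cut_forest peel_adj.
Proof.
have [_ ix_inj _ _] := A_geo; move=> cutT.
case=> [p|[z t]] [q|[z' t']] /=.
- case/and4P=> pA qA cpq /orP[] /eqP E.
    exists [set u | peel_pos u <= ix p]%N; split; rewrite ?inE //=.
      by rewrite E -ltnNge.
    move=> [x|[y s]] [x'|[y' s']] //=; rewrite !inE /=.
    + case/and4P=> xA x'A _ E' h1 h2.
      by split; congr inl; apply: ix_inj => //; move: E'; lia.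
    + by case/andP=> /eqP-> _ h /negP[].
    + by case/andP=> /eqP-> _ h /negP[].
    + by case/andP=> /eqP-> _ h /negP[].
  exists [set u | ix p <= peel_pos u]%N; split; rewrite ?inE //=.
    by rewrite E -ltnNge.
  move=> [x|[y s]] [x'|[y' s']] //=; rewrite !inE /=.
  + case/and4P=> xA x'A _ E' h1 h2.
    by split; congr inl; apply: ix_inj => //; move: E'; lia.
  + by case/andP=> /eqP-> _ h /negP[].
  + by case/andP=> /eqP-> _ h /negP[].
  + by case/andP=> /eqP-> _ h /negP[].
- case/andP=> /eqP-> /eqP->.
  exists [set u | if u is inr (y, _) then y != z' else true]; split; rewrite ?inE ?eqxx //.
  move=> [x|[y s]] [x'|[y' s']] ; rewrite !inE //=.
  + by case/andP=> /eqP-> /eqP-> _; rewrite negbK => /eqP->.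
  + by case/andP=> /eqP-> _ ->.
- case/andP=> /eqP-> /eqP->.
  exists [set u | if u is inr (y, _) then y == z else false]; split; rewrite ?inE ?eqxx //.
  move=> [x|[y s]] [x'|[y' s']] ; rewrite !inE //=.
  + by case/andP=> /eqP-> /eqP-> /eqP-> _.
  + by case/andP=> /eqP-> _ ->.
- case/andP=> /eqP <- {z'} /cutT[S [tS t'S SP]].
  exists [set u | if u is inr (y, s) then if y == z then s \in S else F' z \in S
                  else F' z \in S]; split; rewrite ?inE ?eqxx //.
  move=> [x|[y s]] [x'|[y' s']] //=; rewrite !inE /=.
  + by move=> _ ->.
  + by case/andP=> _ /eqP->; case: eqP => [->|_] ->.
  + by case/andP=> _ /eqP->; case: eqP => [->|_] ->.
  + case/andP=> /eqP <- es; case: eqP => [->|_ ->//] sS s'S.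
    by have [-> ->] := SP _ _ es sS s'S.
Qed.

(** Time is divided into blocks of length [B]. A geodesic vertex [p] stays from time [ix p * B] to
    [(ix p).+1 * B] inclusive, so that neighbours meet at a multiple of [B]. Strictly inside its
    block, the copies hung on [p] run their decompositions, of length [M], one after another. *)
Lemma peel_has_pd s : (0 < s)%N -> has_pd eT s -> has_pd peel_adj s.+1.
Proof.
move=> s0 /(has_pd_covering s0) [M [bT [bfin bcard bedge bconv bcov]]].
have [_ ix_inj _ _] := A_geo.
pose B := (#|V| * M).+1.
pose t0 z := (ix (a z) * B + 1 + enum_rank z * M)%N.
pose bag t := [set u : V + V * T | match u with
  | inl p => (p \in A) && (ix p * B <= t <= (ix p).+1 * B)%N
  | inr (z, y) => (t0 z <= t)%N && (y \in bT (t - t0 z)%N)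
  end].
have t0_lt z : (t0 z + M <= (ix (a z)).+1 * B)%N.
  have hr : ((enum_rank z).+1 * M <= #|V| * M)%N by rewrite leq_mul2r ltn_ord orbT.
  by rewrite /t0 /B; move: hr; rewrite mulSn [(_.+1 * _.+1)%N]mulSn; lia.
have bT_lt y k : y \in bT k -> (k < M)%N.
  by rewrite ltnNge; apply: contraL => /bfin ->; rewrite inE.
have inr_bag t z y : inr (z, y) \in bag t -> (t0 z <= t < t0 z + M)%N.
  by rewrite inE => /andP[h /bT_lt]; lia.
exists ((\max_(z : V) ix z).+2 * B)%N, bag; split.
- have ixmax z : (ix z <= \max_(z : V) ix z)%N by apply: leq_bigmax.
  move=> t nt; apply/setP=> u; rewrite [RHS]inE; apply/negP; case: u => [p|[z y]].
    rewrite inE => /and3P[_ _ h].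
    have := leq_trans nt h; rewrite leq_mul2r /= => h2.
    by have := ixmax p; lia.
  move=> /inr_bag /andP[_ h].
  have := leq_trans (leq_ltn_trans nt h) (t0_lt z); rewrite ltn_mul2r /= => h2.
  by have := ixmax (a z); lia.
- move=> t; pose q := (t %/ B)%N; pose r := (t %% B)%N.
  have tE : t = (q * B + r)%N by apply: divn_eq.
  have rB : (r < B)%N by apply: ltn_pmod.
  pose bl := [set p : V | inl p \in bag t].
  pose br := [set zy : V * T | inr zy \in bag t].
  have -> : bag t = (inl @: bl) :|: (inr @: br).
    apply/setP=> u; rewrite in_setU; case: u => [p|zy].
      rewrite mem_imset ?inE; last by move=> ? ? [].
      case: imsetP => [[? _ //]|_]; by rewrite orbF.
    rewrite [X in _ || X]mem_imset ?inE; last by move=> ? ? [].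
    by case: imsetP => [[? _ //]|_].
  apply: leq_trans (leq_card_setU _ _) _.
  apply: leq_trans (leq_add (leq_imset_card _ _) (leq_imset_card _ _)) _.
  have blP p : p \in bl -> p \in A /\ (ix p = q \/ (r = 0 /\ (ix p).+1 = q))%N.
    rewrite !inE => /and3P[pA h1 h2]; split=> //.
    have h3 : (ix p <= q)%N by rewrite leq_divRL.
    have h4 : (q <= (ix p).+1)%N by rewrite -ltnS ltn_divLR // mulSn; lia.
    have [E|ne] := eqVneq (ix p) q; first by left.
    have E : (ix p).+1 = q by lia.
    by right; split=> //; move: h2; rewrite E tE; lia.
  have brP z y : (z, y) \in br ->
      [/\ (0 < r)%N, ix (a z) = q, (r.-1 %/ M = enum_rank z)%N & y \in bT (r.-1 %% M)%N].
    rewrite inE => h; have /andP[h1 h2] := inr_bag _ _ _ h.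
    have h3 := t0_lt z.
    have h4 : (ix (a z) * B < t < (ix (a z)).+1 * B)%N.
      by move: h1; rewrite /t0; lia.
    have qE : ix (a z) = q.
      apply/eqP; rewrite eqn_leq leq_divRL // -[(q <= _)%N]ltnS ltn_divLR //.
      by case/andP: h4 => /ltnW -> ->.
    have r0 : (0 < r)%N by move: h4; rewrite qE; lia.
    have M0 : (0 < M)%N by lia.
    have rE : (r.-1 = enum_rank z * M + (t - t0 z))%N.
      by move: h1; rewrite /t0 qE; lia.
    have lt : (t - t0 z < M)%N by lia.
    split=> //; first by rewrite rE divnMDl // divn_small ?addn0.
    by rewrite rE modnMDl modn_small //; move: h; rewrite inE => /andP[].
  (* At a multiple of [B] there are at most two geodesic vertices and no copy, and [2 <= s.+1]; at
     any other time there is at most one geodesic vertex beside one bag of [T]. *)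
  have [r0|r0] := posnP r.
    have -> : br = set0.
      by apply/setP=> -[z y]; rewrite [RHS]inE; apply/negP=> /brP[]; rewrite r0.
    rewrite cards0 addn0; apply: leq_trans (_ : 2 <= _)%N => //.
    have -> : bl = [set p in bl | ix p == q] :|: [set p in bl | (ix p).+1 == q].
      apply/setP=> p; apply/idP/setUP => [pb|[] /setIdP[]//].
      by have [_ [E|[_ E]]] := blP p pb; [left|right]; apply/setIdP; rewrite E.
    apply: leq_trans (leq_card_setU _ _) _; apply: (@leq_add _ _ 1 1).
      apply/card_le1_eqP => x y /setIdP[/blP[xA _] /eqP Ex] /setIdP[/blP[yA _] /eqP Ey].
      by apply: ix_inj => //; rewrite Ex Ey.
    apply/card_le1_eqP => x y /setIdP[/blP[xA _] /eqP Ex] /setIdP[/blP[yA _] /eqP Ey].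
    by apply: ix_inj => //; apply: succn_inj; rewrite Ex Ey.
  rewrite -addn1 addnC; apply: leq_add.
    apply: leq_trans (bcard (r.-1 %% M)%N).
    rewrite -(card_in_imset (f := snd)).
      apply: subset_leq_card; apply/subsetP=> y /imsetP[[z y'] /brP[_ _ _ h] ->] //.
    move=> [z y] [z' y'] /brP[_ _ E1 _] /brP[_ _ E2 _] /= ->.
    by congr pair; apply: enum_rank_inj; apply: val_inj; rewrite /= -E1 -E2.
  apply/card_le1_eqP => x y /blP[xA [Ex|[r0' _]]]; last by rewrite r0' in r0.
  move=> /blP[yA [Ey|[r0' _]]]; last by rewrite r0' in r0.
  by apply: ix_inj => //; rewrite Ex Ey.
- have bridge z : exists t, (inl (a z) \in bag t) && (inr (z, F' z) \in bag t).
    have [k Fk] := bcov (F' z); have kM := bT_lt _ _ Fk.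
    exists (t0 z + k)%N; rewrite !inE a_A leq_addr addKn Fk /= andbT.
    by have := t0_lt z; rewrite /t0; lia.
  case=> [p|[z t]] [q|[z' t']] /=.
  + case/and4P=> pA qA _ /orP[] /eqP E.
      by exists (ix q * B)%N; rewrite !inE pA qA E !mulSn; lia.
    by exists (ix p * B)%N; rewrite !inE pA qA E !mulSn; lia.
  + by case/andP=> /eqP-> /eqP->.
  + case/andP=> /eqP-> /eqP->; have [k] := bridge z; exists k.
    by rewrite andbC.
  + case/andP=> /eqP <- /bedge[k /andP[tk t'k]].
    by exists (t0 z + k)%N; rewrite !inE leq_addr addKn tk t'k.
- move=> v i j l /andP[ij jl]; case: v => [p|[z y]]; rewrite !inE.
    by case/and3P=> -> h1 h2 /and3P[_ h3 h4] /=; lia.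
  case/andP=> h1 y1 /andP[h2 y2]; rewrite (leq_trans h1 ij) /=.
  by apply: bconv y1 y2; rewrite !leq_sub2r.
Qed.

Notation dY := (dist peel_adj peel_weight).

Lemma dT_lip t s u : connect eT s u -> dT t u <= dT t s + dT s u.
Proof. exact: dist_lipschitz. Qed.

Lemma c_conn_e x : connect e x (c x).
Proof. exact: del_connect (c_conn x). Qed.

Lemma anchor_A x : anchor x \in A.
Proof. by rewrite /anchor; case: ifP. Qed.

Lemma connect_anchor x : connect e x (anchor x).
Proof.
rewrite /anchor; case: ifP => _; first exact: connect0.
exact: connect_trans (c_conn_e x) (a_conn _).
Qed.

Lemma dist_anchor_le x : d x (anchor x) <= offset x.
Proof.
rewrite /anchor /offset; case: ifP => _; first by rewrite distxx.
have := dist_triangle w_ge0 (c_conn_e x) (a_conn (c x)).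
have := dist_subrel w_ge0 (@del_subrel _ e A) (c_conn x); have := eT_dist (c_conn x).
by lra.
Qed.

(** The steps between consecutive indices have lengths that telescope by additivity of [f]. *)
Lemma peel_line p q : p \in A -> q \in A -> connect e p q ->
  connect peel_adj (inl p) (inl q) /\ dY (inl p) (inl q) <= d p q.
Proof.
have csY := sym_connect_sym peel_sym.
have [_ ix_inj ix_next fP] := A_geo.
wlog le : p q / (ix p <= ix q)%N => [hw pA qA cpq|].
  have [|/ltnW] := leqP (ix p) (ix q) => le; first exact: hw.
  have [] := hw q p le qA pA; first by rewrite cs.
  rewrite csY dist_sym ?(dist_sym w_ge0 e_sym w_sym q p) //.
  - exact: peel_weight_ge0.
  - exact: peel_sym.
  - exact: peel_weight_sym.
move En: (ix q - ix p)%N => n; elim: n p le En => [|n IH] p le En pA qA cpq.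
  have <- : p = q by apply: ix_inj => //; lia.
  by rewrite distxx ?dist_ge0 //; exact: peel_weight_ge0.
have [r [rA cpr Er]] := ix_next p q pA qA cpq ltac:(lia).
have crq : connect e r q by apply: connect_trans cpq; rewrite cs.
have [crq' drq] := IH r ltac:(lia) ltac:(lia) rA qA crq.
have epr : peel_adj (inl p) (inl r) by rewrite /= pA rA cpr Er eqxx.
split; first exact: connect_trans (connect1 epr) crq'.
have := dist_triangle peel_weight_ge0 (connect1 epr) crq'.
have /= := dist_edge peel_weight_ge0 epr.
have h1 := fP p q pA qA cpq ltac:(lia).
have h2 := fP p r pA rA cpr ltac:(lia).
have h3 := fP r q rA qA crq ltac:(lia).
by lra.
Qed.

Lemma peel_copy z t t' : connect eT t t' ->
  connect peel_adj (inr (z, t)) (inr (z, t')) /\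
  dY (inr (z, t)) (inr (z, t')) <= dT t t'.
Proof.
apply: (dist_map (h := fun t => inr (z, t))) => //; first exact: peel_weight_ge0.
by move=> x y exy /=; rewrite eqxx.
Qed.

Lemma peel_map_anchor x :
  connect peel_adj (peel_map x) (inl (anchor x)) /\
  dY (peel_map x) (inl (anchor x)) <= offset x.
Proof.
rewrite /peel_map /anchor /offset; case: ifP => _.
  by rewrite distxx //; exact: peel_weight_ge0.
have cT : connect eT (F' x) (F' (c x)) by rewrite eT_conn.
have [h1 h2] := peel_copy (c x) cT.
have eb : peel_adj (inr (c x, F' (c x))) (inl (a (c x))) by rewrite /= !eqxx.
split; first exact: connect_trans h1 (connect1 eb).
have := dist_triangle peel_weight_ge0 h1 (connect1 eb).
have /= := dist_edge peel_weight_ge0 eb.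
by lra.
Qed.

Lemma peel_dist_le x y : connect e x y ->
  connect peel_adj (peel_map x) (peel_map y) /\
  dY (peel_map x) (peel_map y) <= offset x + d (anchor x) (anchor y) + offset y.
Proof.
have csY := sym_connect_sym peel_sym.
move=> cxy; have [hx1 hx2] := peel_map_anchor x; have [hy1 hy2] := peel_map_anchor y.
have caa : connect e (anchor x) (anchor y).
  apply: connect_trans (connect_trans cxy (connect_anchor y)).
  by rewrite cs connect_anchor.
have [h1 h2] := peel_line (anchor_A x) (anchor_A y) caa.
have hy1' : connect peel_adj (inl (anchor y)) (peel_map y) by rewrite csY.
have h3 := connect_trans h1 hy1'.
split; first exact: connect_trans hx1 h3.
have := dist_triangle peel_weight_ge0 hx1 h3.
have := dist_triangle peel_weight_ge0 h1 hy1'.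
rewrite (dist_sym peel_weight_ge0 peel_sym peel_weight_sym (peel_map y)) in hy2.
by lra.
Qed.

Lemma peel_dist_copy x y : x \notin A -> y \notin A -> c x = c y ->
  connect e' x y -> dY (peel_map x) (peel_map y) <= dT (F' x) (F' y).
Proof.
move=> xA yA cxy exy; rewrite /peel_map (negPf xA) (negPf yA) cxy.
by have [] := @peel_copy (c y) (F' x) (F' y); rewrite ?eT_conn.
Qed.

(** An invariant of connectivity in the new graph: it names the component of [e] over which a vertex
    lies, and so keeps the images of different components apart. *)
Definition component (u : V + V * T) : V :=
  fingraph.root e (match u with inl p => p | inr (z, _) => z end).

Lemma component_peel_map x : component (peel_map x) = fingraph.root e x.
Proof.
rewrite /component /peel_map; case: ifP => _ //.
by apply/esym/eqP; rewrite (root_connect cs) c_conn_e.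
Qed.

Lemma component_const u v : connect peel_adj u v -> component u = component v.
Proof.
case/connectP=> p + ->; elim: p u => //= y p IH u /andP[euy /IH <-].
apply/eqP; rewrite /component (root_connect cs); move: u y euy {IH}.
move=> [q|[z t]] [q'|[z' t']] /=.
- by case/and4P.
- by case/andP=> /eqP-> _; rewrite cs a_conn.
- by case/andP=> /eqP-> _; rewrite a_conn.
- by case/andP=> /eqP->.
Qed.

Lemma peel_connect x y : connect peel_adj (peel_map x) (peel_map y) = connect e x y.
Proof.
apply/idP/idP=> [/component_const|/peel_dist_le[] //].
by rewrite !component_peel_map => /eqP; rewrite (root_connect cs).
Qed.

(* For fixed [x], a lower bound for the distance to [peel_map x] that is
   1-Lipschitz along the edges of the new graph. *)
Definition potential (x : V) (u : V + V * T) : R :=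
  match u with
  | inl q => offset x + d (anchor x) q
  | inr (z, t) =>
      if (x \notin A) && (z == c x) then dT (F' x) t
      else offset x + d (anchor x) (a z) + d z (a z) + dT (F' z) t
  end.

Lemma potential_lip x u v :
  peel_adj u v -> potential x v <= potential x u + peel_weight u v.
Proof.
case: u v => [q|[z t]] [q'|[z' t']] /=.
- case/and4P=> _ _ cqq _.
  by have := dist_lipschitz w_ge0 e_sym (anchor x) cqq; lra.
- case/andP=> /eqP-> /eqP->; case: ifP => [/andP[xA /eqP->]|_].
    have := dist_ge0 e w_ge0 (anchor x) (a (c x)); rewrite /offset (negPf xA).
    by have := dist_ge0 e w_ge0 (c x) (a (c x)); lra.
  by rewrite (distxx eT wT_ge0); lra.
- case/andP=> /eqP-> /eqP->; case: ifP => [/andP[xA /eqP->]|_].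
    by rewrite /offset /anchor (negPf xA) distxx //; lra.
  by rewrite (distxx eT wT_ge0); have := dist_ge0 e w_ge0 z (a z); lra.
- case/andP=> /eqP<- et; have h := dist_edge wT_ge0 et.
  case: ifP => _.
    by have := dT_lip (F' x) (connect1 et); lra.
  by have := dT_lip (F' z) (connect1 et); lra.
Qed.

(** The potential of [x] vanishes at [peel_map x] and is at least [d x y] at [peel_map y]. For [y]
    in another copy this is the triangle inequality along [x], [anchor x], [a (c y)], [c y], [y]; in
    the same copy it is [eT_dist]. *)
Lemma peel_noncontracting x y : connect e x y -> d x y <= dY (peel_map x) (peel_map y).
Proof.
move=> cxy; have cY : connect peel_adj (peel_map x) (peel_map y) by rewrite peel_connect.
have := lipschitz_dist peel_weight_ge0 (@potential_lip x) cY.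
have -> : potential x (peel_map x) = 0.
  rewrite /potential /peel_map /offset /anchor; case: ifP => xA.
    by rewrite distxx // addr0.
  by rewrite /= eqxx distxx.
rewrite add0r; apply: le_trans.
have ax := dist_anchor_le x; have cax : connect e (anchor x) x by rewrite cs connect_anchor.
have cxa := connect_anchor x; have cay := connect_trans cax cxy.
rewrite {1}/peel_map; case: ifP => yA /=.
  by have := dist_triangle w_ge0 cxa cay; lra.
case: ifP => [/andP[xA /eqP cyx]|_].
  have exy : connect e' x y.
    by apply: connect_trans (c_conn x) _; rewrite -cyx cs' c_conn.
  have := eT_dist exy; have := dist_subrel w_ge0 (@del_subrel _ e A) exy; lra.
have h1 := dist_triangle w_ge0 cxa cay.
have cca := a_conn (c y).
have cyc : connect e' (c y) y by rewrite cs'.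
have cyce := del_connect cyc.
have cac : connect e (a (c y)) y by apply: connect_trans cyce; rewrite cs.
have h2 := dist_triangle w_ge0 (connect_trans cay (connect_trans (c_conn_e y) cca)) cac.
have h3 : d (a (c y)) y <= d (a (c y)) (c y) + d (c y) y.
  by apply: dist_triangle => //; rewrite cs.
rewrite (dist_sym w_ge0 e_sym w_sym (a (c y)) (c y)) in h3.
have h4 := eT_dist cyc; have h5 := dist_subrel w_ge0 (@del_subrel _ e A) cyc.
by lra.
Qed.

End Peel.

(** * Induction on the width *)

(** [Om] carries the uniform distribution, and the bound on the expectation is multiplied by
    [#|Om|]. Connectivity is recorded separately because [dist] is [0], not infinite, between
    components. All outcomes share one vertex type, so that the next level can be built on it. *)
Definition forest_embedding (R : realFieldType) (V : finType) (e : rel V)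
    (w : V -> V -> R) (D : R) (s : nat) : Prop :=
  exists (Om Y : finType) (eY : Om -> rel Y) (wY : Om -> Y -> Y -> R)
         (F : Om -> V -> Y),
  [/\ (0 < #|Om|)%N,
      forall o, [/\ symmetric (eY o), irreflexive (eY o), cut_forest (eY o)
                  & has_pd (eY o) s],
      forall o, (forall u v, 0 <= wY o u v) /\ (forall u v, wY o u v = wY o v u),
      forall o x y, connect (eY o) (F o x) (F o y) = connect e x y /\
        (connect e x y -> dist e w x y <= dist (eY o) (wY o) (F o x) (F o y)) &
      forall x y, connect e x y ->
        \sum_o dist (eY o) (wY o) (F o x) (F o y) <= D * #|Om|%:R * dist e w x y].

Lemma edgeless_connect (V : finType) (e : rel V) x y :
  (forall x y, e x y = false) -> connect e x y = (x == y).
Proof.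
move=> e0; apply/idP/eqP => [|->]; last exact: connect0.
by case/connectP=> -[|z p] /=; rewrite ?e0.
Qed.

Lemma edgeless_embedding (R : realFieldType) (V : finType) (e : rel V)
    (w : V -> V -> R) (D : R) (s : nat) :
  (forall x y, 0 <= w x y) -> (forall x y, w x y = w y x) ->
  (forall x y, e x y = false) -> forest_embedding e w D s.
Proof.
move=> w0 ws e0; exists unit, V, (fun _ => e), (fun _ => w), (fun _ => id).
split=> //.
- by rewrite card_unit.
- move=> _; split.
  + by move=> x y; rewrite !e0.
  + by move=> x; rewrite e0.
  + by move=> x y; rewrite e0.
  + exists 0%N, (fun _ => set0); split=> //.
    * by move=> t; rewrite cards0.
    * by move=> x y; rewrite e0.
- move=> x y; rewrite edgeless_connect // => /eqP->.
  by rewrite distxx // mulr0 big1 // => _ _; rewrite distxx.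
Qed.

(* [2023 = 7 * 289]: a cut edge is stretched to at most
   [D * (7 * sg x + 5 * w x y)], and [289 * j] bounds the cutting constant. *)
Fixpoint distortion (k : nat) : nat :=
  if k is j.+1 then (distortion j * (2023 * j + 6))%N else 1%N.

Lemma distortion_gt0 k : (0 < distortion k)%N.
Proof. by elim: k => //= k IH; rewrite muln_gt0 IH addn_gt0 orbT. Qed.

(** Finitely many ratios [u t / v t] have a common bound. With the scale as [u] and the weight as
    [v], this supplies the fineness [N] of the radii. *)
Lemma nat_scale (R : archiRealFieldType) (T : finType)
    (u v : T -> R) : (forall t, 0 <= u t) -> (forall t, 0 <= v t) ->
  exists2 N : nat, (0 < N)%N & forall t, v t = 0 \/ u t <= N%:R * v t.
Proof.
move=> u0 v0; exists (\max_t Num.bound (u t / v t)).+1 => // t.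
have [->|vt] := eqVneq (v t) 0; [by left|right].
have vt0 : 0 < v t by rewrite lt_neqAle eq_sym vt v0.
rewrite -ler_pdivrMr //.
apply: le_trans (ltW (archi_boundP (divr_ge0 (u0 t) (v0 t)))) _.
by rewrite ler_nat; apply: leqW; apply: leq_bigmax.
Qed.

(** By the triangle inequality along a shortest walk, expected stretch has to be bounded on edges
    only. *)
Lemma sum_dist_le (R : realFieldType) (Om V : finType) (e : rel V)
    (w : V -> V -> R) (Y : Om -> finType) (eY : forall o, rel (Y o))
    (wY : forall o, Y o -> Y o -> R) (F : forall o, V -> Y o) (K : R) x y :
  (forall x y, 0 <= w x y) -> (forall o u v, 0 <= wY o u v) ->
  (forall o x y, connect e x y -> connect (eY o) (F o x) (F o y)) ->
  (forall x y, e x y -> \sum_o dist (eY o) (wY o) (F o x) (F o y) <= K * w x y) ->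
  connect e x y ->
  \sum_o dist (eY o) (wY o) (F o x) (F o y) <= K * dist e w x y.
Proof.
move=> w0 wY0 conn edge /(dist_attained w0) [p [pp <- _ <-]].
elim: p x pp => [|z p IH] x /=.
  by move=> _; rewrite mulr0 big1 // => o _; rewrite distxx.
case/andP=> exz pp; rewrite mulrDr; apply: le_trans (lerD (edge _ _ exz) (IH _ pp)).
rewrite -big_split /=; apply: ler_sum => o _; apply: dist_triangle => //.
  exact: conn (connect1 exz).
by apply: conn; apply: path_conn pp _ (mem_last _ _).
Qed.

Lemma nearest_point (R : realFieldType) (V : finType) (e : rel V)
    (w : V -> V -> R) (A : {set V}) x :
  (exists2 a, a \in A & connect e x a) ->
  exists a, [/\ a \in A, connect e x a &
    forall b, b \in A -> connect e x b -> dist e w x a <= dist e w x b].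
Proof.
case=> a0 a0A xa0.
have Pa0 : (a0 \in A) && connect e x a0 by rewrite a0A.
case: (@arg_minP _ _ _ a0 (fun a => (a \in A) && connect e x a)
  (fun a => dist e w x a) Pa0) => a /andP[aA xa] mina.
by exists a; split=> // b bA xb; apply: mina; rewrite bA.
Qed.

Lemma embedding_step (R : archiRealFieldType) (V : finType) (e : rel V)
    (w : V -> V -> R) (D : R) (k : nat) :
  (forall x y, 0 <= w x y) -> (forall x y, w x y = w y x) ->
  symmetric e -> irreflexive e -> has_pd e k.+2 -> 1 <= D ->
  (forall e' : rel V, symmetric e' -> irreflexive e' -> has_pd e' k.+1 ->
    forest_embedding e' w D k.+1) ->
  forest_embedding e w (D * (2023 * k%:R + 6)) k.+2.
Proof.
move=> w0 ws es ei pd D1 IH.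
have cs := sym_connect_sym es.
have [A [ix [f [geo pd']]]] := exists_geodesic_system w0 es pd.
have es' := del_sym A es; have ei' := del_irr A ei.
have cs' := sym_connect_sym es'.
have [Om [T [eT [wT [F' [Om0 treeT wTP F'P F'sum]]]]]] := IH _ es' ei' pd'.
have [Ahit _ _ _] := geo.
have [a aP] := fin_all_exists (fun x => nearest_point w (Ahit x)).
have aA x : a x \in A by case: (aP x).
have ac x : connect e x (a x) by case: (aP x).
have amin x b : b \in A -> connect e x b -> dist e w x (a x) <= dist e w x b.
  by case: (aP x) => _ _; apply.
pose sg x := dist e w x (a x).
have sg0 x : 0 <= sg x by apply: dist_ge0.
have sgA x : x \in A -> sg x = 0.
  move=> xA; apply/eqP; rewrite eq_le sg0 andbT -(distxx e w0 x).
  exact: amin (connect0 _ _).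
have sg_lip x y : e x y -> sg y <= sg x + w x y.
  move=> exy; have cyx : connect e y x by rewrite cs connect1.
  have := amin y (a x) (aA x) (connect_trans cyx (ac x)).
  have := dist_triangle w0 cyx (ac x); have := dist_edge w0 exy.
  by rewrite (dist_sym w0 es ws y x) /sg; lra.
have sg_lip' x y : del e A x y -> sg y <= sg x + w x y.
  by move=> /del_subrel; apply: sg_lip.
have [N N0 Nbig] := nat_scale
  (fun p : V * V => sg0 p.1) (fun p : V * V => w0 p.1 p.2).
have Nbig' x y : del e A x y -> w x y = 0 \/ sg x <= N%:R * w x y.
  by move=> _; apply: (Nbig (x, y)).
have [c [cnear ccut]] := exists_centers w0 ws es' ei' pd' sg0 sg_lip' N0 Nbig'.
have c_conn i x : connect (del e A) x (c i x) by case: (cnear i x).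
pose F (o : 'I_N * Om) := peel_map A (F' o.2) (c o.1).
pose eY (o : 'I_N * Om) := peel_adj e A ix (eT o.2) (F' o.2) a.
pose wY (o : 'I_N * Om) := peel_weight e w (wT o.2).
have eT_sym o : symmetric (eT o) by case: (treeT o).
have eT_irr o : irreflexive (eT o) by case: (treeT o).
have wT_ge0 o u v : 0 <= wT o u v by case: (wTP o).
have wT_sym o u v : wT o u v = wT o v u by case: (wTP o).
have T_conn o x y : connect (eT o) (F' o x) (F' o y) = connect (del e A) x y.
  by case: (F'P o x y).
have T_dist o x y : connect (del e A) x y ->
    dist (del e A) w x y <= dist (eT o) (wT o) (F' o x) (F' o y).
  by case: (F'P o x y).
have wY0 o u v : 0 <= wY o u v by apply: peel_weight_ge0.
have F_conn o x y : connect (eY o) (F o x) (F o y) = connect e x y.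
  by apply: (peel_connect w0 es ws geo (wT_ge0 o.2)).
(* Drawing the pair uniformly makes the radius index independent of the outcome for the deleted
   graph, so averages over [Om] may be taken for each fixed index. *)
exists ('I_N * Om)%type, (V + V * T)%type, eY, wY, F; split=> //.
- by rewrite card_prod card_ord muln_gt0 N0.
- move=> o; split.
  + by apply: peel_sym.
  + by apply: peel_irr.
  + by apply: (peel_cut_forest geo); case: (treeT o.2).
  + by apply: (peel_has_pd geo) => //; case: (treeT o.2).
- by move=> o; split=> // u v; apply: peel_weight_sym.
- move=> o x y; split=> // cxy.
  exact: (peel_noncontracting w0 es ws geo (wT_ge0 o.2) (eT_sym o.2)
    (wT_sym o.2) (T_conn o.2) (T_dist o.2) (c_conn o.1) aA ac cxy).
move=> x0 y0; apply: (@sum_dist_le _ _ _ e w (fun=> (V + V * T)%type) eY wY F)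
  => // [o x y|x y exy]; first by rewrite F_conn.
have M0 : 0 < (#|Om|%:R : R) by rewrite ltr0n.
rewrite card_prod card_ord natrM -(pair_bigA _ (fun i o =>
  dist (eY (i, o)) (wY (i, o)) (F (i, o) x) (F (i, o) y))) /=.
set M := #|Om|%:R in M0 *.
(* The centre is within [sg z / 3] of [z]: this costs [D / 3] on average inside the copy, and the
   bridge has length at most [sg z / 3 + sg z]. *)
have off_sum i z : \sum_o offset e w A (eT o) (wT o) (F' o) (c i) a z
    <= M * (D / 3 + 4 / 3) * sg z.
  have [zA|zA] := boolP (z \in A).
    by rewrite sgA // mulr0 big1 // => o _; rewrite /offset zA.
  have [_ h] := cnear i z.
  rewrite (eq_bigr (fun o => dist (eT o) (wT o) (F' o z) (F' o (c i z))
    + dist e w (c i z) (a (c i z)))); last first.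
    by move=> o _; rewrite /offset (negPf zA).
  rewrite big_split /= sumr_const -mulr_natl -/M.
  have h1 := F'sum _ _ (c_conn i z).
  have cze := del_connect (c_conn i z); have cez : connect e (c i z) z by rewrite cs.
  have h2 := amin (c i z) (a z) (aA z) (connect_trans cez (ac z)).
  have h3 := dist_triangle w0 cez (ac z).
  rewrite (dist_sym w0 es ws (c i z) z) in h3.
  have h4 := dist_subrel w0 (@del_subrel _ e A) (c_conn i z).
  have h5 : dist e w (c i z) (a (c i z)) <= 4 / 3 * sg z by rewrite /sg in h *; lra.
  have h6 : M * dist e w (c i z) (a (c i z)) <= M * (4 / 3 * sg z).
    by rewrite ler_pM2l.
  have h7 : D * M * dist (del e A) w z (c i z) <= D * M * (sg z / 3).
    by apply: ler_wpM2l; [rewrite mulr_ge0 ?ltW //; lra | lra].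
  by lra.
have anch i z : dist e w z (anchor A (c i) a z) <= 5 / 3 * sg z.
  rewrite /anchor; case: ifP => zA; first by rewrite distxx //; have := sg0 z; lra.
  have [_ h] := cnear i z.
  have cze := del_connect (c_conn i z); have cez : connect e (c i z) z by rewrite cs.
  have h2 := amin (c i z) (a z) (aA z) (connect_trans cez (ac z)).
  have h3 := dist_triangle w0 cez (ac z).
  rewrite (dist_sym w0 es ws (c i z) z) in h3.
  have h4 := dist_subrel w0 (@del_subrel _ e A) (c_conn i z).
  have h5 := dist_triangle w0 cze (ac (c i z)).
  by rewrite /sg in h *; lra.
(* Two offsets and the stretch between the anchors give the coefficient [D / 3 + 4 / 3 + 5 / 3], at
   most [10 / 3 * D] because [1 <= D]. *)
have general i : \sum_o dist (eY (i, o)) (wY (i, o)) (F (i, o) x) (F (i, o) y)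
    <= M * (D * (10 / 3 * (sg x + sg y) + w x y)).
  apply: le_trans (_ : \sum_o (offset e w A (eT o) (wT o) (F' o) (c i) a x
     + dist e w (anchor A (c i) a x) (anchor A (c i) a y)
     + offset e w A (eT o) (wT o) (F' o) (c i) a y) <= _).
    apply: ler_sum => o _.
    have [|_] := @peel_dist_le R V e w w0 es ws A ix f geo T (eT o) (wT o) (F' o)
      (wT_ge0 o) (eT_sym o) (wT_sym o) (T_conn o) (c i) a (c_conn i) aA ac x y.
      exact: connect1.
    by [].
  rewrite !big_split /= sumr_const -mulr_natl -/M.
  have h1 := off_sum i x; have h2 := off_sum i y.
  have ax := anch i x; have ay := anch i y.
  have cxy := connect1 exy.
  have cax : connect e x (anchor A (c i) a x) by apply: connect_anchor.
  have cay : connect e y (anchor A (c i) a y) by apply: connect_anchor.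
  have cxa : connect e (anchor A (c i) a x) x by rewrite cs.
  have h3 := dist_triangle w0 cxa (connect_trans cxy cay).
  have h4 := dist_triangle w0 cxy cay.
  have h5 := dist_edge w0 exy.
  rewrite (dist_sym w0 es ws _ x) in h3.
  have h6 : dist e w (anchor A (c i) a x) (anchor A (c i) a y)
    <= 5 / 3 * (sg x + sg y) + w x y by lra.
  have h7 : M * dist e w (anchor A (c i) a x) (anchor A (c i) a y)
    <= M * (5 / 3 * (sg x + sg y) + w x y) by rewrite ler_pM2l.
  apply: le_trans (_ : M * ((D / 3 + 3) * (sg x + sg y) + w x y) <= _).
    by lra.
  rewrite ler_pM2l //.
  have := sg0 x; have := sg0 y; have := w0 x y; nra.
have sgxy := sg_lip _ _ exy.
have [exy'|nexy'] := boolP (del e A x y); last first.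
  (* One endpoint lies on [A], where the scale vanishes, so the general bound is already
     proportional to [w x y]. *)
  have sgs : sg x + sg y <= w x y.
    move: nexy'; rewrite /del exy /= negb_and !negbK => /orP[] h.
      by have hx := sgA x h; lra.
    have hy := sgA y h.
    by have := sg_lip y x; rewrite es exy => /(_ isT); rewrite ws; lra.
  apply: le_trans (_ : \sum_(i < N) M * (D * (10 / 3 * (sg x + sg y) + w x y)) <= _).
    by apply: ler_sum => i _; apply: general.
  rewrite sumr_const card_ord -[leLHS]mulr_natl.
  have -> : D * (2023 * k%:R + 6) * (N%:R * M) * w x y =
    N%:R * (M * (D * ((2023 * k%:R + 6) * w x y))) by ring.
  apply: ler_wpM2l => //; rewrite ler_pM2l // ler_pM2l; last by lra.
  have : 0 <= k%:R * w x y by rewrite mulr_ge0.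
  by have := w0 x y; lra.
have [_ xA yA] := and3P exy'.
have termwise i : \sum_o dist (eY (i, o)) (wY (i, o)) (F (i, o) x) (F (i, o) y)
    <= M * D * (w x y + (c i x != c i y)%:R * (7 * sg x + 5 * w x y)).
  have [E|_] := eqVneq (c i x) (c i y); last first.
    apply: le_trans (general i) _; rewrite mul1r -[leRHS]mulrA ler_pM2l // ler_pM2l; last by lra.
    by have := w0 x y; have := sg0 x; lra.
  rewrite mul0r addr0.
  apply: le_trans (_ : \sum_o dist (eT o) (wT o) (F' o x) (F' o y) <= _).
    apply: ler_sum => o _.
    apply: (@peel_dist_copy R V e w w0 A ix T (eT o) (wT o) (F' o)
      (wT_ge0 o) (T_conn o) (c i) a x y xA yA E).
    exact: connect1.
  apply: le_trans (F'sum _ _ (connect1 exy')) _.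
  rewrite -/M [D * M]mulrC; apply: ler_wpM2l (dist_edge w0 exy').
  by apply: mulr_ge0; lra.
apply: le_trans (ler_sum _ (fun i _ => termwise i)) _.
rewrite -mulr_sumr big_split /= sumr_const card_ord -mulr_natl -mulr_suml.
have -> : \sum_(i < N) (c i x != c i y)%:R = #|[set i | c i x != c i y]|%:R :> R.
  rewrite -natr_sum -sum1dep_card; congr _%:R.
  by rewrite [RHS]big_mkcond /=; apply: eq_bigr => i _; case: (_ != _).
have := ccut _ _ exy' => /=.
have : #|[set i | c i x != c i y]|%:R <= N%:R :> R.
  by rewrite ler_nat -[leqRHS]card_ord max_card.
set C := #|_|%:R => CN cutC.
have -> : D * (2023 * k%:R + 6) * (N%:R * M) * w x y =
    M * D * (N%:R * w x y * (2023 * k%:R + 6)) by ring.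
apply: ler_wpM2l; first by apply: mulr_ge0; lra.
have h8 : C * w x y <= N%:R * w x y by apply: ler_wpM2r.
(* The cut indices contribute [7 * 289 * k] through [cutC] and [5] through [h8]; the uncut distance
   contributes [1]. *)
by lra.
Qed.

Theorem pathwidth_forest_embedding (R : archiRealFieldType) (V : finType)
    (k : nat) (e : rel V) (w : V -> V -> R) :
  (forall x y, 0 <= w x y) -> (forall x y, w x y = w y x) ->
  symmetric e -> irreflexive e -> has_pd e k.+1 ->
  forest_embedding e w (distortion k)%:R k.+1.
Proof.
move=> w0 ws; elim: k e => [|k IH] e es ei pd.
  by apply: edgeless_embedding => //; apply: has_pd1_edgeless pd _.
rewrite /= natrM natrD natrM; apply: embedding_step => //.
by rewrite ler1n distortion_gt0.
Qed.

(** From [j] to [j.+1] the exponent grows by at least [5], and [2023 * j + 6 <= (4 * j.+1) ^ 5]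
    because [4 * j.+1 >= 8] and [8 ^ 4 = 4096]. *)
Lemma distortion_le k : (0 < k)%N -> (distortion k <= (4 * k) ^ (k ^ 3 + 1))%N.
Proof.
elim: k => // -[|k] IH _ //.
rewrite [distortion _]/=; have {}IH := IH isT; set j := k.+1 in IH *.
rewrite -/(distortion j).
have step : (j ^ 3 + 1 + 5 <= j.+1 ^ 3 + 1)%N by rewrite !expnS !expn0 /j; nia.
apply: leq_trans (_ : (4 * j.+1) ^ (j ^ 3 + 1 + 5) <= _)%N; last first.
  by rewrite leq_pexp2l.
rewrite expnD; apply: leq_mul.
  by apply: leq_trans IH _; rewrite leq_exp2r ?addn1 // leq_mul2l leqnSn orbT.
have h8 : (8 ^ 4 <= (4 * j.+1) ^ 4)%N by rewrite leq_exp2r // /j; lia.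
have := leq_mul (leqnn (4 * j.+1)%N) h8; rewrite -expnS; apply: leq_trans.
by rewrite (_ : 8 ^ 4 = 4096)%N //; lia.
Qed.

(** * Acyclicity, restriction to closed vertex sets and edge lengths *)

(** The rest of a cycle through the edge from [x] to [y] leads back from [y] to [x], hence into [S],
    but the only crossing edge is already used up. The induction follows the cycle and shows that it
    never enters [S]. *)
Lemma cut_forest_acyclic (Y : finType) (e : rel Y) :
  symmetric e -> cut_forest e -> forall c, ucycle e c -> (size c <= 2)%N.
Proof.
move=> es cut [//|x [//|y [//|z q]]] /andP[/= /and3P[exy eyz pz]].
rewrite !inE !negb_or => /and4P[/and3P[_ xz xq] /andP[yz yq] _ _].
have [S [xS yS SP]] := cut x y exy.
have zS : z \notin S.
  apply/negP=> zS; have [zx _] := SP z y (etrans (es z y) eyz) zS yS.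
  by rewrite zx eqxx in xz.
elim: q z pz zS yz yq {eyz xz xq} => [|v q IH] z /=.
  rewrite andbT => ezx zS yz _; have [_ zy] := SP x z (etrans (es x z) ezx) xS zS.
  by rewrite zy eqxx in yz.
case/andP=> ezv pv zS yz; rewrite inE negb_or => /andP[yv yq].
apply: IH pv _ yv yq; apply/negP=> vS.
have [_ zy] := SP v z (etrans (es v z) ezv) vS zS.
by rewrite zy eqxx in yz.
Qed.

Section Restrict.
Variables (R : realFieldType) (Y : finType) (e : rel Y) (w : Y -> Y -> R).
Variable P : pred Y.
Local Notation sub_adj := (relpre (val : {y | P y} -> Y) e).
Local Notation sub_weight := (fun u v : {y | P y} => w (val u) (val v)).

Lemma restrict_cut_forest : cut_forest e -> cut_forest sub_adj.
Proof.
move=> cut x y /cut[S [xS yS SP]]; exists [set u | val u \in S].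
rewrite !inE; split=> // u v euv; rewrite !inE => uS vS.
by have [/val_inj -> /val_inj ->] := SP _ _ euv uS vS.
Qed.

Lemma restrict_has_pd s : has_pd e s -> has_pd sub_adj s.
Proof.
case=> n [b [bfin bcard bedge bconv]].
exists n, (fun t => [set u | val u \in b t]); split.
- by move=> t nt; apply/setP=> u; rewrite !inE bfin // inE.
- move=> t; apply: leq_trans (bcard t); rewrite -(card_imset _ val_inj).
  by apply: subset_leq_card; apply/subsetP=> _ /imsetP[u + ->]; rewrite inE.
- by move=> x y /bedge[t xyt]; exists t; rewrite !inE.
- by move=> v i j l ijl; rewrite !inE; apply: bconv.
Qed.

(** As [P] is closed under adjacency, every walk that starts in [P] lifts to the subtype with the
    same length. *)
Lemma restrict_dist u v : (forall x y, 0 <= w x y) ->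
  (forall x y, e x y -> P x -> P y) ->
  connect sub_adj u v = connect e (val u) (val v) /\
  dist sub_adj sub_weight u v = dist e w (val u) (val v).
Proof.
move=> w0 Pe.
have lift p (u' : {y | P y}) : path e (val u') p -> exists q : seq {y | P y},
    [/\ path sub_adj u' q, map val q = p & wlen sub_weight u' q = wlen w (val u') p].
  elim: p u' => [|y p IH] u' /=; first by exists [::].
  case/andP=> euy; have Py := Pe _ _ euy (valP u').
  rewrite -[y]/(val (exist P y Py : {y | P y})) => /IH[q [pq mq wq]].
  by exists (exist P y Py :: q); rewrite /= pq mq wq andbT.
have s0 x y : 0 <= sub_weight x y by [].
have map_d : connect sub_adj u v ->
    connect e (val u) (val v) /\ dist e w (val u) (val v) <= dist sub_adj sub_weight u v.
  exact: dist_map.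
have lift_d : connect e (val u) (val v) -> connect sub_adj u v /\
    dist sub_adj sub_weight u v <= dist e w (val u) (val v).
  case/(dist_attained w0)=> p [pp lp _ <-]; have [q [pq mq wq]] := lift _ _ pp.
  have lq : last u q = v by apply: val_inj; rewrite -lp -mq last_map.
  split; first by apply/connectP; exists q.
  by rewrite -wq -lq; apply: dist_le.
have cE : connect sub_adj u v = connect e (val u) (val v).
  by apply/idP/idP => [/map_d[]|/lift_d[]].
split=> //; have [cuv|ncuv] := boolP (connect sub_adj u v).
  by apply/eqP; rewrite eq_le (map_d cuv).2 (lift_d (map_d cuv).1).2.
by rewrite !dist_not_connect // -cE.
Qed.

End Restrict.

(** Any ordered representative of the pair may be picked, because [w] is symmetric. *)
Lemma weight_of_edges (R : realFieldType) (Y : finType) (w : Y -> Y -> R) :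
  (forall u v, w u v = w v u) ->
  exists len : {set Y} -> R, forall u v, len [set u; v] = w u v.
Proof.
move=> ws.
exists (fun E => if [pick p | E == [set p.1; p.2]] is Some p then w p.1 p.2 else 0).
move=> u v; case: pickP => [[p q] /= /eqP E|/(_ (u, v))]; last by rewrite /= eqxx.
have : p \in [set u; v] by rewrite E set21.
have : q \in [set u; v] by rewrite E set22.
have : u \in [set p; q] by rewrite -E set21.
have : v \in [set p; q] by rewrite -E set22.
rewrite !inE => /pred2P[]-> /pred2P[]-> //; rewrite ?orbb.
- by move=> /eqP->.
- by move=> _ /eqP->.
Qed.

(** * Graphs, extended distances and probability *)

From mathcomp Require Import all_classical all_reals all_analysis.
From mathcomp Require Import measurable_realfun.

Lemma Pathwidth_has_pd (k : nat) (V : finType) (G : sgraph V) :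
  Pathwidth k G -> has_pd G k.+1.
Proof.
rewrite /Pathwidth /pathwidth; case: ex_minnP => m /asboolP[n [bag [[cov edge conv] wm]]] _ mk.
exists n.+1, (fun t => if (t < n.+1)%N then bag (inord t) else finset.set0); split.
- by move=> t nt; rewrite ltnNge nt.
- move=> t; case: ifP => _; last by rewrite cards0.
  apply: leq_trans (_ : (\max_(i < n.+1) #|bag i|) <= _)%N; first exact: leq_bigmax.
  by move: wm mk; rewrite /width => <-; case: (\max_(i < n.+1) _)%N.
- move=> x y /edge[i xyi]; exists (val i); rewrite ltn_ord.
  by rewrite (_ : inord (val i) = i) //; apply: val_inj; rewrite /= inordK.
- move=> v i j l /andP[ij jl]; case: ltnP => // ni; last by rewrite inE.
  case: (ltnP l) => // nl; last by rewrite inE.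
  have nj := leq_ltn_trans jl nl; rewrite nj; apply: conv.
  by rewrite !inordK // ij.
Qed.

Lemma has_pd_Pathwidth (k : nat) (V : finType) (G : sgraph V) :
  has_pd G k.+1 -> Pathwidth k G.
Proof.
move=> /has_pd_covering[//|n [b [bfin bcard bedge bconv bcov]]].
have lt_n v t : v \in b t -> (t < n.+1)%N.
  by rewrite ltnS leqNgt; apply: contraL => /ltnW /bfin ->; rewrite inE.
rewrite /Pathwidth /pathwidth; case: ex_minnP => m _.
(* The index type of a path decomposition is nonempty, so the empty bag [b n] is included. *)
pose bag (i : 'I_n.+1) := b (val i).
move=> /(_ (width bag)) min; apply: leq_trans (min _) _; last first.
  have : (\max_(i < n.+1) #|bag i| <= k.+1)%N by apply/bigmax_leqP => i _; apply: bcard.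
  by rewrite /width; case: (\max_(i < n.+1) _)%N.
apply/asboolP; exists n, bag; split=> //; split.
- by move=> v; have [t vt] := bcov v; exists (Ordinal (lt_n _ _ vt)).
- move=> x y /bedge[t xyt]; have [xt _] := andP xyt.
  by exists (Ordinal (lt_n _ _ xt)).
- by move=> v i j l ijl; apply: bconv ijl.
Qed.

Lemma shortest_pathE (R : realType) (V : finType) (G : sgraph V)
    (len : {set V} -> R) (w : V -> V -> R) x y :
  (forall u v, 0 <= w u v) -> (forall u v, G u v -> len [set u; v]%SET = w u v) ->
  shortest_path G len x y = if connect G x y then (dist G w x y)%:E else +oo%E.
Proof.
move=> w0 lenw.
have wl z p : path G z p -> walk_length len z p = wlen w z p.
  rewrite /walk_length; elim: p z => [|v p IH] z /=; first by rewrite big_nil.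
  by case/andP=> gzv /IH h; rewrite big_cons h lenw.
rewrite /shortest_path; case: ifP => cxy.
  apply/eqP; rewrite eq_le; apply/andP; split.
    have [p [pp lp _ <-]] := dist_attained w0 cxy.
    by apply: ereal_inf_lbound; exists p; rewrite ?wl.
  apply: le_ereal_inf_tmp => _ [p /= [pp <-] <-].
  by rewrite wl // lee_fin dist_le.
rewrite (_ : [set _ | _ in _]%classic = set0) ?ereal_inf0 //.
apply/seteqP; split=> // z [p /= [pp lp] _]; move: cxy.
by have -> : connect G x y by apply/connectP; exists p.
Qed.

(** * The uniform distribution on a finite sample space *)

Section UniformOnOrdinals.
Variables (R : realType) (n : nat).
Local Open Scope ereal_scope.

Lemma uniform_weight_ge0 : (0 <= n.+1%:R^-1 :> R)%R.
Proof. by rewrite invr_ge0. Qed.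

(** The distribution lives on [nat] with mass on the first [n.+1] numbers: all sets of naturals are
    measurable, which makes every random distance measurable. *)
Definition uniform_nat : set nat -> \bar R :=
  mscale (NngNum uniform_weight_ge0) (msum (fun i : nat => \d_i) n.+1).

HB.instance Definition _ := Measure.on uniform_nat.

Lemma uniform_nat_setT : uniform_nat [set: nat]%classic = 1.
Proof.
rewrite /uniform_nat /mscale /= /msum /=.
under eq_bigr do rewrite diracT.
rewrite sumEFin sumr_const card_ord -EFinM /= mulVf //.
Qed.

HB.instance Definition _ :=
  Measure_isProbability.Build _ _ R uniform_nat uniform_nat_setT.

Lemma integral_uniform_nat (f : nat -> \bar R) : (forall i, 0 <= f i) ->
  \int[uniform_nat]_i f i = (n.+1%:R^-1)%:E * \sum_(i < n.+1) f i.
Proof.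
move=> f0; rewrite ge0_integral_mscale //=.
rewrite ge0_integral_measure_sum //; congr (_ * _).
by apply: eq_bigr => i _; rewrite integral_dirac // diracT mul1e.
Qed.

End UniformOnOrdinals.

Lemma uniform_stochastic_embedding (R : realType) (D : R) (X : finType)
    (d : X -> X -> \bar R) (Ys : metric_family R) (Om : finType)
    (Y : Om -> finType) (dY : forall o, Y o -> Y o -> \bar R)
    (F : forall o, X -> Y o) :
  (0 < #|Om|)%N ->
  (forall o, Ys (Y o) (dY o)) ->
  (forall o u v, 0 <= dY o u v)%E ->
  (forall o x y, d x y <= dY o (F o x) (F o y))%E ->
  (forall x y, (d x y < +oo)%E ->
    (\sum_o dY o (F o x) (F o y) <= (D * #|Om|%:R)%:E * d x y)%E) ->
  stochastic_embedding D d Ys.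
Proof.
move=> Om0 YsP dY0 expand avg.
case En : #|Om| Om0 => [//|n] _.
have Om1 : (0 < #|Om|)%N by rewrite En.
have /card_gt0P Om_ex := Om1; case: Om_ex => o0 _.
(* Numbers beyond the enumeration have mass zero; the default [o0] still gives them a target in the
   family and a noncontracting map. *)
pose oc (i : nat) : Om := nth o0 (enum Om) i.
exists _, nat, (uniform_nat R n), (fun i => Y (oc i)), (fun i => dY (oc i)),
  (fun i => F (oc i)); split=> //.
- by apply: aeW => i x y; apply: expand.
- move=> x y dxy; rewrite integral_uniform_nat //.
  have -> : (\sum_(i < n.+1) dY (oc i) (F (oc i) x) (F (oc i) y) =
             \sum_o dY o (F o x) (F o y))%E.
    rewrite -[RHS]big_enum /= (big_nth o0) -cardE En big_mkord.
    by apply: eq_bigr.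
  rewrite lee_pdivrMl ?ltr0n //.
  by apply: le_trans (avg _ _ dxy) _; rewrite En mulrC EFinM muleA.
Qed.

(** The family [Fam] is left open so that one argument serves both trees, for connected [G], and
    forests, for general [G]. *)
Lemma stochastic_embedding_of_forests (R : realType) (D : R) (k : nat)
    (X : finType) (G : sgraph X) (d : X -> X -> \bar R) (Fam : graph_family) :
  (forall w : X -> X -> R, (forall x y, 0 <= w x y) ->
     (forall x y, w x y = w y x) -> forest_embedding G w D k.+1) ->
  supported_on G d ->
  (forall (Y : finType) (GY : sgraph Y), Acyclic GY -> Pathwidth k GY ->
     (Connected G -> Connected GY) -> Fam Y GY) ->
  stochastic_embedding D d (metrics_supported_on (R := R) Fam).
Proof.
move=> emb [len [len0 dE]] FamP.
(* Lengths are known to be nonnegative on edges only, so the weight is set to [0] elsewhere. *)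
pose w x y := if G x y then len [set x; y]%SET else 0.
have w0 x y : 0 <= w x y.
  rewrite /w; case: ifP => // Gxy; apply: len0.
  by apply/imsetP; exists (x, y) => //; rewrite inE.
have ws x y : w x y = w y x by rewrite /w adj_sym finset.setUC.
have {}dE x y : d x y = if connect G x y then (dist G w x y)%:E else +oo%E.
  by rewrite dE; apply: shortest_pathE => // u v Guv; rewrite /w Guv.
have [Om [Y [eY [wY [F [Om0 tree wYP FP Fsum]]]]]] := emb w w0 ws.
have eY_sym o : symmetric (eY o) by case: (tree o).
have wY0 o u v : 0 <= wY o u v by case: (wYP o).
(* Only the components that contain an image point are kept: the target is then
   connected whenever [G] is. *)
pose P o : pred Y := fun y => [exists x, connect (eY o) (F o x) y].
have PF o x : P o (F o x) by apply/existsP; exists x; apply: connect0.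
have Pe o u v : eY o u v -> P o u -> P o v.
  move=> euv /existsP[x xu]; apply/existsP; exists x.
  exact: connect_trans xu (connect1 euv).
pose Y' o : finType := {y | P o y}.
pose eY' o : rel (Y' o) := relpre val (eY o).
have eY'_sym o : symmetric (eY' o) by move=> u v; apply: eY_sym.
have eY'_irr o : irreflexive (eY' o).
  by move=> u; case: (tree o) => _ irr _ _; apply: irr.
pose GY o : sgraph (Y' o) := SGraph (@eY'_sym o) (@eY'_irr o).
pose wY' o (u v : Y' o) : R := wY o (val u) (val v).
have [lenY lenYE] : exists lenY : forall o, {set Y' o} -> R,
    forall o u v, lenY o [set u; v]%SET = wY' o u v.
  apply: (@fin_all_exists Om (fun o => {set Y' o} -> R)
    (fun o l => forall u v, l [set u; v]%SET = wY' o u v)) => o.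
  apply: weight_of_edges => u v.
  by case: (wYP o) => _; apply.
pose dY o := shortest_path (GY o) (lenY o).
pose F' o x : Y' o := exist (P o) (F o x) (PF o x).
have dYE o u v : dY o u v = if connect (eY o) (val u) (val v)
    then (dist (eY o) (wY o) (val u) (val v))%:E else +oo%E.
  rewrite /dY (@shortest_pathE _ _ _ _ (wY' o)) //; last by move=> *; apply: wY0.
  by have [-> ->] := restrict_dist u v (wY0 o) (Pe o).
apply: (uniform_stochastic_embedding (F := F') (dY := dY) Om0).
- move=> o; exists (GY o); split; last first.
    exists (lenY o); split=> // E /imsetP[[u v] _ ->] /=.
    by rewrite lenYE; apply: wY0.
  case: (tree o) => _ _ cut pd; apply: FamP.
  + apply: cut_forest_acyclic; first exact: eY'_sym.
    exact: restrict_cut_forest.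
  + by apply: has_pd_Pathwidth; apply: restrict_has_pd.
  + move=> Gconn u v; have [-> _] := restrict_dist u v (wY0 o) (Pe o).
    have [x xu] := existsP (valP u); have [y yv] := existsP (valP v).
    have xy : connect (eY o) (F o x) (F o y) by rewrite (FP o x y).1; apply: Gconn.
    apply: connect_trans (connect_trans xy yv).
    by rewrite (sym_connect_sym (@eY_sym o)).
- move=> o u v; rewrite dYE; case: ifP => // _.
  by rewrite lee_fin dist_ge0.
- move=> o x y; rewrite dYE dE /= (FP o x y).1; case: ifP => // cxy.
  by rewrite lee_fin; apply: (FP o x y).2.
- move=> x y; rewrite dE; case: ifP => // cxy _.
  under eq_bigr do rewrite dYE /= (FP _ x y).1 cxy.
  by rewrite sumEFin -EFinM lee_fin; apply: Fsum.
Qed.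

(** Distances in a tree are finite, so no tree metric dominates a metric with infinite distances.
    Hence connected graphs are embedded into trees, and arbitrary graphs into forests. *)
Theorem theorem1p5 (R : realType) (k : nat) :
  (embeds R (inter_family Connected (Pathwidth k))
            (inter_family Trees (Pathwidth k)) /\
   exists D : R, D <= (4 * k%:R) ^+ (k ^ 3 + 1) /\
     embeds_with D (inter_family Connected (Pathwidth k))
                   (inter_family Trees (Pathwidth k))) /\
  (embeds R (Pathwidth k) (inter_family Acyclic (Pathwidth k)) /\
   exists D : R, D <= (4 * k%:R) ^+ (k ^ 3 + 1) /\
     embeds_with D (Pathwidth k) (inter_family Acyclic (Pathwidth k))).
Proof.
have [D [D_le emb]] : exists D : R, D <= (4 * k%:R) ^+ (k ^ 3 + 1) /\
    forall (X : finType) (G : sgraph X) (w : X -> X -> R), Pathwidth k G ->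
      (forall x y, 0 <= w x y) -> (forall x y, w x y = w y x) ->
      forest_embedding G w D k.+1.
  have [->|k0] := posnP k.
    (* For [k = 0] the bound is [0 ^ 1 = 0]. It is met because the graph has no edges, so every
       finite distance is zero. *)
    exists 0; split; first by rewrite mulr0 expr1.
    move=> X G w /Pathwidth_has_pd pd w0 ws; apply: edgeless_embedding => //.
    exact: has_pd1_edgeless (adj_irrefl G) pd _.
  exists (distortion k)%:R; split.
    by rewrite -natrM -natrX ler_nat distortion_le.
  move=> X G w /Pathwidth_has_pd pd w0 ws.
  exact: pathwidth_forest_embedding (adj_sym G) (adj_irrefl G) pd.
have connected : embeds_with D (inter_family Connected (Pathwidth k))
                               (inter_family Trees (Pathwidth k)).
  move=> X d [G [[Gc Gk] Gd]]; apply: (stochastic_embedding_of_forests _ Gd).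
    by move=> w; apply: emb.
  by move=> Y GY GYa GYk GYc; split=> //; split=> //; apply: GYc.
have general : embeds_with D (Pathwidth k) (inter_family Acyclic (Pathwidth k)).
  move=> X d [G [Gk Gd]]; apply: (stochastic_embedding_of_forests _ Gd).
    by move=> w; apply: emb.
  by move=> Y GY GYa GYk _; split.
by split; split; exists D.
Qed.
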